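(* Let $K$ be a field and let $\mathcal{L}$ denote the set of purely infinite simple $K$-algebras $\{\mathrm{M}_d(L_n)\mid d,n\in\mathbb{N},\ d\ge 1,\ n\ge 2\}$. Let $B,B'\in\mathcal{L}$. Then $B\cong B'$ (as $K$-algebras) if and only if there is a group isomorphism $\phi:K_0(B)\to K_0(B')$ for which $\phi([1_B])=[1_{B'}]$.
   Context: For a field $K$ and an integer $n\ge 2$, the Leavitt algebra $L_n=L_K(1,n)$ is the unital associative $K$-algebra generated by $x_1,\dots,x_n,y_1,\dots,y_n$ subject to the relations $x_iy_j=\delta_{ij}1$ for $1\le i,j\le n$ and $\sum_{j=1}^n y_jx_j=1$. $\mathrm{M}_d(R)$ is the ring of $d\times d$ matrices over $R$. $K_0(B)$ is the Grothendieck group of finitely generated projective (left) $B$-modules, and $[1_B]\in K_0(B)$ is the class of the free module of rank one. *)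

(* Defs.v *)
From HB Require Import structures.
From mathcomp Require Import all_boot all_algebra.
From mathcomp Require Import generic_quotient boolp.

Set Implicit Arguments.
Unset Strict Implicit.
Unset Printing Implicit Defensive.

Import GRing.Theory.

Local Open Scope ring_scope.
Local Open Scope quotient_scope.

(* The Leavitt algebra is presented by generators and relations: formal       *)
(* expressions in the x_i, the y_j and the constants k of K, modulo the least *)
(* congruence [lveq] containing the axioms of unital associative K-algebras   *)
(* and the Leavitt relations. The scalar action of k is multiplication by the *)
(* central constant [LvC k].                                                  *)
Inductive lvterm (K : Type) (n : nat) : Type :=
| LvX of 'I_n
| LvY of 'I_n
| LvC of K
| LvAdd of lvterm K n & lvterm K n
| LvMul of lvterm K n & lvterm K n.

Arguments LvX {K n} i.
Arguments LvY {K n} i.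
Arguments LvC {K n} k.
Arguments LvAdd {K n} s t.
Arguments LvMul {K n} s t.

Inductive lveq (K : fieldType) (n : nat) : lvterm K n -> lvterm K n -> Prop :=
| lv_refl t : lveq t t
| lv_sym s t : lveq s t -> lveq t s
| lv_trans s t u : lveq s t -> lveq t u -> lveq s u
| lv_congD s s' t t' :
    lveq s s' -> lveq t t' -> lveq (LvAdd s t) (LvAdd s' t')
| lv_congM s s' t t' :
    lveq s s' -> lveq t t' -> lveq (LvMul s t) (LvMul s' t')
| lv_addA s t u : lveq (LvAdd s (LvAdd t u)) (LvAdd (LvAdd s t) u)
| lv_addC s t : lveq (LvAdd s t) (LvAdd t s)
| lv_add0 t : lveq (LvAdd (LvC 0) t) t
| lv_addN t : lveq (LvAdd (LvMul (LvC (-1)) t) t) (LvC 0)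
| lv_mulA s t u : lveq (LvMul s (LvMul t u)) (LvMul (LvMul s t) u)
| lv_mul1 t : lveq (LvMul (LvC 1) t) t
| lv_mulDl s t u : lveq (LvMul (LvAdd s t) u) (LvAdd (LvMul s u) (LvMul t u))
| lv_mulDr s t u : lveq (LvMul s (LvAdd t u)) (LvAdd (LvMul s t) (LvMul s u))
| lv_constD k l : lveq (LvC (k + l)) (LvAdd (LvC k) (LvC l))
| lv_constM k l : lveq (LvC (k * l)) (LvMul (LvC k) (LvC l))
| lv_constC k t : lveq (LvMul (LvC k) t) (LvMul t (LvC k))
| lv_xy i j : lveq (LvMul (LvX i) (LvY j)) (LvC (i == j)%:R)
| lv_yx : lveq (\big[LvAdd/LvC 0]_(j < n) LvMul (LvY j) (LvX j)) (LvC 1).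

HB.instance Definition _ (K : Type) n := gen_eqMixin (lvterm K n).
HB.instance Definition _ (K : Type) n := gen_choiceMixin (lvterm K n).

Section Leavitt.
Variables (K : fieldType) (n : nat).

Definition lveqb (s t : lvterm K n) : bool := `[< lveq s t >].

Lemma lveqb_refl : reflexive lveqb.
Proof. by move=> t; apply/asboolP/lv_refl. Qed.

Lemma lveqb_sym : symmetric lveqb.
Proof. by move=> s t; apply/asboolP/asboolP; apply: lv_sym. Qed.

Lemma lveqb_trans : transitive lveqb.
Proof.
by move=> t s u /asboolP st /asboolP tu; apply/asboolP/(lv_trans st tu).
Qed.

Canonical lveqb_equiv := EquivRel lveqb lveqb_refl lveqb_sym lveqb_trans.

Definition leavitt := {eq_quot lveqb}.
HB.instance Definition _ := Choice.on leavitt.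
HB.instance Definition _ := EqQuotient.on leavitt.

Lemma lv_piP (s t : lvterm K n) : \pi_leavitt s = \pi_leavitt t <-> lveq s t.
Proof.
by split=> [/eqmodP/asboolP // | st]; apply/eqmodP/asboolP.
Qed.

Definition lv_lift2 (op : lvterm K n -> lvterm K n -> lvterm K n)
  (a b : leavitt) : leavitt := \pi_leavitt (op (repr a) (repr b)).

Definition lv_add := lv_lift2 LvAdd.
Definition lv_mul := lv_lift2 LvMul.
Definition lv_const (k : K) : leavitt := \pi_leavitt (LvC k).
Definition lv_opp := lv_mul (lv_const (-1)).

Lemma lv_repr (t : lvterm K n) : lveq (repr (\pi_leavitt t)) t.
Proof. by apply/lv_piP; rewrite reprK. Qed.

Lemma lv_addE s t :
  lv_add (\pi_leavitt s) (\pi_leavitt t) = \pi_leavitt (LvAdd s t).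
Proof. by apply/lv_piP; apply: lv_congD; apply: lv_repr. Qed.

Lemma lv_mulE s t :
  lv_mul (\pi_leavitt s) (\pi_leavitt t) = \pi_leavitt (LvMul s t).
Proof. by apply/lv_piP; apply: lv_congM; apply: lv_repr. Qed.

Let lvE := (lv_addE, lv_mulE).

Fact lv_addrA : associative lv_add.
Proof.
elim/quotW=> s; elim/quotW=> t; elim/quotW=> u.
by rewrite (lv_addE t u) (lv_addE s t) !lv_addE;
  apply/lv_piP; apply: lv_addA.
Qed.
Fact lv_addrC : commutative lv_add.
Proof.
by elim/quotW=> s; elim/quotW=> t; rewrite !lvE;
  apply/lv_piP; apply: lv_addC.
Qed.
Fact lv_add0r : left_id (lv_const 0) lv_add.
Proof. by elim/quotW=> s; rewrite !lvE; apply/lv_piP; apply: lv_add0. Qed.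
Fact lv_addNr : left_inverse (lv_const 0) lv_opp lv_add.
Proof.
by elim/quotW=> s; rewrite /lv_opp (lv_mulE (LvC (-1)) s) lv_addE;
  apply/lv_piP; apply: lv_addN.
Qed.
Fact lv_mulrA : associative lv_mul.
Proof.
elim/quotW=> s; elim/quotW=> t; elim/quotW=> u.
by rewrite (lv_mulE t u) (lv_mulE s t) !lv_mulE;
  apply/lv_piP; apply: lv_mulA.
Qed.
Fact lv_constCr k a : lv_mul (lv_const k) a = lv_mul a (lv_const k).
Proof. by elim/quotW: a => s; rewrite !lvE; apply/lv_piP; apply: lv_constC. Qed.
Fact lv_mul1r : left_id (lv_const 1) lv_mul.
Proof. by elim/quotW=> s; rewrite !lvE; apply/lv_piP; apply: lv_mul1. Qed.
Fact lv_mulr1 : right_id (lv_const 1) lv_mul.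
Proof. by move=> a; rewrite -lv_constCr lv_mul1r. Qed.
Fact lv_mulrDl : left_distributive lv_mul lv_add.
Proof.
elim/quotW=> s; elim/quotW=> t; elim/quotW=> u.
by rewrite (lv_addE s t) (lv_mulE s u) (lv_mulE t u) lv_mulE lv_addE;
  apply/lv_piP; apply: lv_mulDl.
Qed.
Fact lv_mulrDr : right_distributive lv_mul lv_add.
Proof.
elim/quotW=> s; elim/quotW=> t; elim/quotW=> u.
by rewrite (lv_addE t u) (lv_mulE s u) (lv_mulE s t) lv_mulE lv_addE;
  apply/lv_piP; apply: lv_mulDr.
Qed.

HB.instance Definition _ := GRing.isZmodule.Build leavitt
  lv_addrA lv_addrC lv_add0r lv_addNr.
HB.instance Definition _ := GRing.Zmodule_isPzRing.Build leavitt
  lv_mulrA lv_mul1r lv_mulr1 lv_mulrDl lv_mulrDr.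

Definition lv_scale (k : K) (a : leavitt) : leavitt := lv_const k * a.

Fact lv_scalerA k l a : lv_scale k (lv_scale l a) = lv_scale (k * l) a.
Proof.
rewrite /lv_scale mulrA; congr (_ * _).
by rewrite [LHS]lv_mulE; apply/lv_piP; apply: lv_sym; apply: lv_constM.
Qed.
Fact lv_scale1r : left_id 1 lv_scale.
Proof. exact: mul1r. Qed.
Fact lv_scalerDr : right_distributive lv_scale +%R.
Proof. by move=> k a b; apply: mulrDr. Qed.
Fact lv_scalerDl a : {morph lv_scale^~ a : k l / k + l}.
Proof.
move=> k l; rewrite /lv_scale -mulrDl; congr (_ * _).
by rewrite [RHS]lv_addE; apply/lv_piP; apply: lv_constD.
Qed.

HB.instance Definition _ := GRing.Zmodule_isLmodule.Build K leavitt
  lv_scalerA lv_scale1r lv_scalerDr lv_scalerDl.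

Definition lv_x (i : 'I_n) : leavitt := \pi_leavitt (LvX i).
Definition lv_y (i : 'I_n) : leavitt := \pi_leavitt (LvY i).

Lemma lv_xyE i j : lv_x i * lv_y j = (i == j)%:R.
Proof.
rewrite [LHS]lv_mulE; apply: etrans (proj2 (lv_piP _ _) (lv_xy K i j)) _.
by case: (i == j).
Qed.

Lemma lv_yxE : \sum_(j < n) lv_y j * lv_x j = 1.
Proof.
apply: etrans (proj2 (lv_piP _ _) (lv_yx K n)).
elim/big_rec2: _ => // j a t _ ->.
by rewrite [_ * _]lv_mulE [LHS]lv_addE.
Qed.

End Leavitt.

(* [leavitt K 0] is the zero ring; the others are nontrivial because they act *)
(* on the functions nat -> K, with x_i f = (m |-> f (n * m + i)).             *)
Section LeavittNontrivial.
Variables (K : fieldType) (n' : nat).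
Let n := n'.+1.

Fixpoint lv_act (t : lvterm K n) (f : nat -> K) : nat -> K :=
  match t with
  | LvX i => fun m => f (m * n + i)%N
  | LvY i => fun m => if (m %% n)%N == i :> nat then f (m %/ n)%N else 0
  | LvC k => fun m => k * f m
  | LvAdd s t => fun m => lv_act s f m + lv_act t f m
  | LvMul s t => lv_act s (lv_act t f)
  end.

Lemma eq_lv_act t f g : f =1 g -> lv_act t f =1 lv_act t g.
Proof.
elim: t f g => [i|i|k|s IHs t IHt|s IHs t IHt] f g fg m /=.
- by rewrite fg.
- by rewrite fg.
- by rewrite fg.
- by rewrite (IHs _ _ fg) (IHt _ _ fg).
- by apply: IHs; apply: IHt.
Qed.

Lemma lv_actD t f g m :
  lv_act t (fun k => f k + g k) m = lv_act t f m + lv_act t g m.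
Proof.
elim: t f g m => [i|i|k|s IHs t IHt|s IHs t IHt] f g m /=.
- by [].
- by case: ifP => _; rewrite ?addr0.
- by rewrite mulrDr.
- by rewrite IHs IHt addrACA.
- by rewrite -IHs; apply: eq_lv_act => k; rewrite IHt.
Qed.

Lemma lv_actZ t (c : K) f m : lv_act t (fun k => c * f k) m = c * lv_act t f m.
Proof.
elim: t f m => [i|i|k|s IHs t IHt|s IHs t IHt] f m /=.
- by [].
- by case: ifP => _; rewrite ?mulr0.
- by rewrite mulrCA.
- by rewrite IHs IHt mulrDr.
- by rewrite -IHs; apply: eq_lv_act => k; rewrite IHt.
Qed.

Lemma lv_act_eq s t : lveq s t -> forall f, lv_act s f =1 lv_act t f.
Proof.
elim=> {s t} /=.
- by [].
- by move=> s t _ st f m; rewrite st.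
- by move=> s t u _ st _ tu f m; rewrite st tu.
- by move=> s s' t t' _ ss _ tt f m; rewrite ss tt.
- move=> s s' t t' _ ss _ tt f m; rewrite ss.
  by apply: eq_lv_act => k; rewrite tt.
- by move=> s t u f m; rewrite addrA.
- by move=> s t f m; rewrite addrC.
- by move=> t f m; rewrite mul0r add0r.
- by move=> t f m; rewrite mulN1r addNr mul0r.
- by [].
- by move=> t f m; rewrite mul1r.
- by [].
- by move=> s t u f m; rewrite lv_actD.
- by move=> k l f m; rewrite mulrDl.
- by move=> k l f m; rewrite mulrA.
- by move=> k t f m; rewrite lv_actZ.
- move=> i j f m; rewrite modnMDl modn_small // divnMDl // divn_small // addn0.
  by rewrite (inj_eq val_inj); case: (i == j); rewrite ?mul1r ?mul0r.
- move=> f m; rewrite mul1r.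
  have -> : lv_act (\big[LvAdd/LvC 0]_(j < n) LvMul (LvY j) (LvX j)) f m =
      \sum_(j < n) if (m %% n)%N == j :> nat then f (m %/ n * n + j)%N else 0.
    elim/big_ind2: _ => //=; first by rewrite mul0r.
    by move=> t a u b -> ->.
  have mn : (m %% n < n)%N by rewrite ltn_mod.
  rewrite (bigD1 (Ordinal mn)) //= eqxx -divn_eq big1 ?addr0 // => j.
  by rewrite -(inj_eq val_inj) /= eq_sym => /negPf ->.
Qed.

Fact lv_oner_neq0 : (1 : leavitt K n) != 0.
Proof.
apply/eqP => /lv_piP/lv_act_eq/(_ (fun=> 1) 0%N)/= /eqP.
by rewrite !mulr1 oner_eq0.
Qed.

Fact lv_scalerAl (k : K) (a b : leavitt K n) : k *: (a * b) = k *: a * b.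
Proof. exact: mulrA. Qed.

Fact lv_scalerAr (k : K) (a b : leavitt K n) : k *: (a * b) = a * (k *: b).
Proof.
rewrite [LHS]mulrA [_ * a]lv_constCr; exact/esym/mulrA.
Qed.

HB.instance Definition _ :=
  GRing.PzSemiRing_isNonZero.Build (leavitt K n) lv_oner_neq0.
HB.instance Definition _ :=
  GRing.Lmodule_isLalgebra.Build K (leavitt K n) lv_scalerAl.
HB.instance Definition _ :=
  GRing.Lalgebra_isAlgebra.Build K (leavitt K n) lv_scalerAr.

End LeavittNontrivial.

(* 'M[A]_d is canonically a module over A in the library; this alias carries  *)
(* the structure of a K-algebra, with entrywise scalar action of K.           *)
Definition matalg (K : fieldType) (A : algType K) (d : nat) := 'M[A]_d.

Section MatrixAlgebra.
Variables (K : fieldType) (A : algType K).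

Section AnySize.
Variable d : nat.
HB.instance Definition _ := GRing.PzRing.copy (matalg A d) 'M[A]_d.

Definition matalg_scale (k : K) (M : matalg A d) : matalg A d :=
  map_mx ( *:%R k) M.

Fact matalg_scalerA k l M :
  matalg_scale k (matalg_scale l M) = matalg_scale (k * l) M.
Proof. by apply/matrixP=> i j; rewrite !mxE scalerA. Qed.
Fact matalg_scale1r : left_id 1 matalg_scale.
Proof. by move=> M; apply/matrixP=> i j; rewrite !mxE scale1r. Qed.
Fact matalg_scalerDr : right_distributive matalg_scale +%R.
Proof. by move=> k M N; apply/matrixP=> i j; rewrite !mxE scalerDr. Qed.
Fact matalg_scalerDl M : {morph matalg_scale^~ M : k l / k + l}.
Proof. by move=> k l; apply/matrixP=> i j; rewrite !mxE scalerDl. Qed.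

HB.instance Definition _ := GRing.Zmodule_isLmodule.Build K (matalg A d)
  matalg_scalerA matalg_scale1r matalg_scalerDr matalg_scalerDl.
End AnySize.

Section PositiveSize.
Variable d : nat.
HB.instance Definition _ := GRing.NzRing.copy (matalg A d.+1) 'M[A]_d.+1.

Fact matalg_scalerAl (k : K) (M N : matalg A d.+1) : k *: (M * N) = k *: M * N.
Proof.
apply/matrixP=> i j; rewrite !mxE scaler_sumr.
by apply: eq_bigr => h _; rewrite !mxE scalerAl.
Qed.
Fact matalg_scalerAr (k : K) (M N : matalg A d.+1) :
  k *: (M * N) = M * (k *: N).
Proof.
apply/matrixP=> i j; rewrite !mxE scaler_sumr.
by apply: eq_bigr => h _; rewrite !mxE scalerAr.
Qed.

HB.instance Definition _ :=
  GRing.Lmodule_isLalgebra.Build K (matalg A d.+1) matalg_scalerAl.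
HB.instance Definition _ :=
  GRing.Lalgebra_isAlgebra.Build K (matalg A d.+1) matalg_scalerAr.
End PositiveSize.
End MatrixAlgebra.

Definition alg_iso (K : fieldType) (A B : algType K) : Prop :=
  exists f : {lrmorphism A -> B}, bijective f.

Definition linear_iso (R : pzRingType) (M N : lmodType R) : Prop :=
  exists f : {linear M -> N}, bijective f.

Definition fin_generated (R : pzRingType) (M : lmodType R) : Prop :=
  exists (n : nat) (v : 'I_n -> M),
    forall x : M, exists c : 'I_n -> R, x = \sum_(i < n) c i *: v i.

Definition projective (R : pzRingType) (M : lmodType R) : Prop :=
  forall (S T : lmodType R) (p : {linear S -> T}) (g : {linear M -> T}),
    (forall y : T, exists x : S, p x = y) ->
    exists h : {linear M -> S}, forall m : M, p (h m) = g m.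

Section ModuleFacts.
Variable R : pzRingType.
Implicit Types M N P : lmodType R.

Lemma exists_linear M N (f : M -> N) :
  linear f -> exists g : {linear M -> N}, g =1 f.
Proof.
move=> flin; pose m := GRing.isLinear.Build _ _ _ _ f flin.
pose g : {linear M -> N} := HB.pack f m.
by exists g.
Qed.

Lemma linear_iso_refl M : linear_iso M M.
Proof.
have [|f fE] := @exists_linear M M id; first by [].
by exists f; exists id => x; rewrite fE.
Qed.

Lemma linear_iso_sym M N : linear_iso M N -> linear_iso N M.
Proof.
case=> f [g fK gK]; have [|h hE] := @exists_linear _ _ g.
  by move=> a x y; apply: (can_inj fK); rewrite linearP !gK.
by exists h; exists f => x; rewrite hE.
Qed.

Lemma linear_iso_trans M N P :
  linear_iso M N -> linear_iso N P -> linear_iso M P.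
Proof.
case=> f bf [g bg].
have [|h hE] := @exists_linear _ _ (g \o f).
  by move=> a x y; rewrite /= !linearP.
by exists h; apply: (eq_bij (bij_comp bg bf)) => x; rewrite hE.
Qed.

Lemma linear_iso_prod M M' N N' : linear_iso M M' -> linear_iso N N' ->
  linear_iso (M * N)%type (M' * N')%type.
Proof.
case=> f [f' fK f'K] [g [g' gK g'K]].
have [|h hE] := @exists_linear (M * N)%type (M' * N')%type
    (fun x => (f x.1, g x.2)).
  by move=> a x y; rewrite /= !linearP.
exists h; exists (fun x => (f' x.1, g' x.2)) => [[x y]|[x y]];
  by rewrite hE /= ?fK ?gK ?f'K ?g'K.
Qed.

Lemma linear_iso_prodC M N : linear_iso (M * N)%type (N * M)%type.
Proof.
have [|h hE] := @exists_linear (M * N)%type (N * M)%type (fun x => (x.2, x.1)).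
  by [].
by exists h; exists (fun x => (x.2, x.1)) => [[x y]|[x y]]; rewrite hE.
Qed.

Lemma linear_iso_prodA M N P :
  linear_iso (M * (N * P))%type (M * N * P)%type.
Proof.
have [|h hE] := @exists_linear (M * (N * P))%type (M * N * P)%type
   (fun x => (x.1, x.2.1, x.2.2)); first by [].
exists h; exists (fun x => (x.1.1, (x.1.2, x.2))) => [[x [y z]]|[[x y] z]];
  by rewrite hE.
Qed.

Lemma linear_iso_prod0 M : linear_iso ('rV[R]_0 * M)%type M.
Proof.
have [|h hE] := @exists_linear ('rV[R]_0 * M)%type M (fun x => x.2).
  by move=> a [x y] [z t].
exists h; exists (fun x => (0, x)) => [[x y]|x]; rewrite hE //=.
by rewrite [x]thinmx0.
Qed.

Lemma fin_generated_iso M N :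
  linear_iso M N -> fin_generated M -> fin_generated N.
Proof.
case=> f [g fK gK] [n [v vgen]]; exists n, (f \o v) => x.
have [c cE] := vgen (g x); exists c.
by rewrite -[LHS]gK cE linear_sum; apply: eq_bigr => i _; rewrite linearZ.
Qed.

Lemma projective_iso M N : linear_iso M N -> projective M -> projective N.
Proof.
move=> MN; have [f' _] := MN; case: (linear_iso_sym MN) => g [f gK fK] pM.
have [|f0 f0E] := @exists_linear _ _ f.
  by move=> a x y; apply: (can_inj gK); rewrite linearP !fK.
move=> S T p u psurj.
have [|u0 u0E] := @exists_linear _ _ (u \o f0).
  by move=> a x y; rewrite /= !linearP.
have [h hE] := pM S T p u0 psurj.
have [|h0 h0E] := @exists_linear _ _ (h \o g).
  by move=> a x y; rewrite /= !linearP.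
by exists h0 => x; rewrite h0E /= hE u0E /= f0E gK.
Qed.

Lemma fin_generated_prod M N :
  fin_generated M -> fin_generated N -> fin_generated (M * N)%type.
Proof.
move=> [m [v vgen]] [n [w wgen]].
pose u i := match split i with inl j => (v j, 0) | inr k => (0, w k) end.
exists (m + n)%N, u => -[x y].
have [c cE] := vgen x; have [b bE] := wgen y.
exists (fun i => match split i with inl j => c j | inr k => b k end).
rewrite big_split_ord /=.
have -> : \sum_(i < m) (match split (lshift n i) with
    inl j => c j | inr k => b k end) *: u (lshift n i) = (x, 0 : N).
  rewrite cE (eq_bigr (fun i => c i *: ((v i, 0) : M * N))); last first.
    by move=> i _; rewrite /u (unsplitK (inl _ i)).
  elim: (index_enum _) => [|i r IHr]; rewrite ?big_nil // !big_cons IHr.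
  by congr (_, _); rewrite /= scaler0 addr0.
have -> : \sum_(i < n) (match split (rshift m i) with
    inl j => c j | inr k => b k end) *: u (rshift m i) = (0 : M, y).
  rewrite bE (eq_bigr (fun i => b i *: ((0, w i) : M * N))); last first.
    by move=> i _; rewrite /u (unsplitK (inr _ i)).
  elim: (index_enum _) => [|i r IHr]; rewrite ?big_nil // !big_cons IHr.
  by congr (_, _); rewrite /= scaler0 addr0.
by congr (_, _); rewrite /= ?addr0 ?add0r.
Qed.

Lemma projective_prod M N :
  projective M -> projective N -> projective (M * N)%type.
Proof.
move=> pM pN S T p u psurj.
have [|u1 u1E] := @exists_linear M T (fun x => u (x, 0)).
  move=> a x y; rewrite -linearP; congr (u (_, _)).
  by rewrite /= scaler0 addr0.
have [|u2 u2E] := @exists_linear N T (fun x => u (0, x)).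
  move=> a x y; rewrite -linearP; congr (u (_, _)).
  by rewrite /= scaler0 addr0.
have [h1 h1E] := pM S T p u1 psurj; have [h2 h2E] := pN S T p u2 psurj.
have [|h hE] := @exists_linear (M * N)%type S (fun x => h1 x.1 + h2 x.2).
  by move=> a x y; rewrite /= !linearP /= scalerDr addrACA.
exists h => -[x y]; rewrite hE /= linearD h1E h2E u1E u2E -linearD.
by congr (u (_, _)); rewrite /= ?addr0 ?add0r.
Qed.

Lemma fin_generated_rV0 : fin_generated 'rV[R]_0.
Proof.
exists 0%N, (fun=> 0) => x; exists (fun=> 0).
by rewrite big_ord0 thinmx0.
Qed.

Lemma projective_rV0 : projective 'rV[R]_0.
Proof.
move=> S T p u _; have [|h hE] := @exists_linear 'rV[R]_0 S (fun=> 0).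
  by move=> a x y; rewrite scaler0 addr0.
by exists h => x; rewrite hE thinmx0 !linear0.
Qed.

Lemma fin_generated_regular : fin_generated R^o.
Proof.
exists 1%N, (fun=> 1) => x; exists (fun=> x).
by rewrite big_ord1 [RHS]mulr1.
Qed.

Lemma projective_regular : projective R^o.
Proof.
move=> S T p u psurj; have [s sE] := psurj (u 1).
have [|h hE] := @exists_linear R^o S (fun a => (a : R) *: s).
  by move=> a x y; rewrite scalerDl scalerA.
exists h => x; rewrite hE linearZ sE -linearZ.
by congr (u _); rewrite /= [LHS]mulr1.
Qed.

End ModuleFacts.

(* The finitely generated projective modules in lmodType R form a type that   *)
(* is too large to underlie a zmodType. K0 is therefore built from those that *)
(* are submodules of some R^n; by [fgproj_repr_exists] every finitely         *)
(* generated projective module is isomorphic to one of these.                 *)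
Record submodule (R : pzRingType) := Submodule {
  sm_rank : nat;
  sm_pred : 'rV[R]_sm_rank -> bool;
  sm_closed : subsemimod_closed sm_pred
}.

Definition sm_sort (R : pzRingType) (P : submodule R) :=
  {v : 'rV[R]_(sm_rank P) | sm_pred v}.

HB.instance Definition _ (R : pzRingType) (P : submodule R) :=
  SubChoice.on (sm_sort P).
HB.instance Definition _ (R : pzRingType) (P : submodule R) :=
  GRing.SubChoice_isSubLmodule.Build R 'rV[R]_(sm_rank P) (@sm_pred R P)
    (sm_sort P) (sm_closed P).

Record fgproj (R : pzRingType) := FgProj {
  fgp_sub : submodule R;
  fgp_fg : fin_generated (sm_sort fgp_sub);
  fgp_proj : projective (sm_sort fgp_sub)
}.

Arguments fgp_proj {R} f.

Definition fgp_mod (R : pzRingType) (P : fgproj R) : lmodType R :=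
  sm_sort (fgp_sub P).
Coercion fgp_mod : fgproj >-> GRing.Lmodule.type.

Lemma fgproj_repr_exists (R : pzRingType) (M : lmodType R) :
  fin_generated M -> projective M -> exists P : fgproj R, linear_iso M P.
Proof.
move=> fgM pM; have [n [v vgen]] := fgM.
have [|p pE] := @exists_linear R 'rV[R]_n M (fun c => \sum_i c 0 i *: v i).
  move=> a x y; rewrite scaler_sumr -big_split; apply: eq_bigr => i _ /=.
  by rewrite !mxE scalerDl scalerA.
have [|i iE] := @exists_linear R M M id; first by [].
have [|s sE] := pM _ _ p i.
  move=> y; have [c ->] := vgen y; exists (\row_j c j).
  by rewrite pE; apply: eq_bigr => j _; rewrite mxE.
pose Q := [pred w : 'rV[R]_n | s (p w) == w].
have Qcl : subsemimod_closed Q.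
  split; first split.
  - by rewrite inE !linear0.
  - by move=> x y; rewrite !inE => /eqP xE /eqP yE; rewrite !linearD xE yE.
  - by move=> a x; rewrite !inE => /eqP xE; rewrite !linearZ /= xE.
pose P := Submodule Qcl.
have sQ m : Q (s m) by rewrite /= sE iE.
have [|f fE] := @exists_linear R M (sm_sort P) (fun m => exist _ (s m) (sQ m)).
  by move=> a x y; apply: val_inj; rewrite /= !linearP.
have MP : linear_iso M (sm_sort P).
  exists f; exists (fun w : sm_sort P => p (sval w)) => [m|w];
    rewrite ?fE /= ?sE ?iE //.
  by apply: val_inj; apply/eqP; exact: (svalP w).
by exists (FgProj (fin_generated_iso MP fgM) (projective_iso MP pM)).
Qed.

Definition fgproj_repr (R : pzRingType) (M : lmodType R)
    (fgM : fin_generated M) (pM : projective M) : fgproj R :=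
  sval (cid (fgproj_repr_exists fgM pM)).

Lemma fgproj_reprP (R : pzRingType) (M : lmodType R)
  (fgM : fin_generated M) (pM : projective M) :
  linear_iso M (fgproj_repr fgM pM).
Proof. exact: svalP (cid (fgproj_repr_exists fgM pM)). Qed.

HB.instance Definition _ (R : pzRingType) := gen_eqMixin (fgproj R).
HB.instance Definition _ (R : pzRingType) := gen_choiceMixin (fgproj R).

(* The monoid of isomorphism classes of finitely generated projective left    *)
(* R-modules under direct sum.                                                *)
Section IsoClasses.
Variable R : pzRingType.

Definition fgp_isob (P Q : fgproj R) : bool := `[< linear_iso P Q >].

Lemma fgp_isob_refl : reflexive fgp_isob.
Proof. by move=> P; apply/asboolP/linear_iso_refl. Qed.

Lemma fgp_isob_sym : symmetric fgp_isob.
Proof. by move=> P Q; apply/asboolP/asboolP; apply: linear_iso_sym. Qed.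

Lemma fgp_isob_trans : transitive fgp_isob.
Proof.
by move=> Q P S /asboolP PQ /asboolP QS; apply/asboolP/(linear_iso_trans PQ QS).
Qed.

Canonical fgp_isob_equiv :=
  EquivRel fgp_isob fgp_isob_refl fgp_isob_sym fgp_isob_trans.

Definition isoclass := {eq_quot fgp_isob}.
HB.instance Definition _ := Choice.on isoclass.
HB.instance Definition _ := EqQuotient.on isoclass.

Definition class_of (M : lmodType R) (fgM : fin_generated M)
  (pM : projective M) : isoclass := \pi_isoclass (fgproj_repr fgM pM).

Lemma isoclassP (P Q : fgproj R) :
  \pi_isoclass P = \pi_isoclass Q <-> linear_iso P Q.
Proof.
by split=> [/eqmodP/asboolP // | PQ]; apply/eqmodP/asboolP.
Qed.

Definition fgp_add (P Q : fgproj R) : fgproj R :=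
  fgproj_repr (fin_generated_prod (fgp_fg P) (fgp_fg Q))
              (projective_prod (fgp_proj P) (fgp_proj Q)).

Definition iso_add (a b : isoclass) : isoclass :=
  \pi_isoclass (fgp_add (repr a) (repr b)).

Definition iso_zero : isoclass :=
  class_of (fin_generated_rV0 R) (@projective_rV0 R).

Lemma fgp_addP (P Q : fgproj R) : linear_iso (P * Q)%type (fgp_add P Q).
Proof. exact: fgproj_reprP. Qed.

Lemma iso_addE (P Q : fgproj R) :
  iso_add (\pi_isoclass P) (\pi_isoclass Q) = \pi_isoclass (fgp_add P Q).
Proof.
apply/isoclassP; apply: linear_iso_trans (fgp_addP _ _).
apply: linear_iso_trans (linear_iso_sym (fgp_addP _ _)) _.
by apply: linear_iso_prod; apply/isoclassP; rewrite reprK.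
Qed.

Fact iso_addA : associative iso_add.
Proof.
elim/quotW=> P; elim/quotW=> Q; elim/quotW=> S.
rewrite (iso_addE Q S) (iso_addE P Q) !iso_addE.
apply/isoclassP; apply: linear_iso_trans (linear_iso_sym (fgp_addP _ _)) _.
apply: linear_iso_trans (linear_iso_prod (linear_iso_refl _)
  (linear_iso_sym (fgp_addP _ _))) _.
apply: linear_iso_trans (linear_iso_prodA _ _ _) _.
apply: linear_iso_trans (fgp_addP _ _).
exact: linear_iso_prod (fgp_addP _ _) (linear_iso_refl _).
Qed.

Fact iso_addC : commutative iso_add.
Proof.
elim/quotW=> P; elim/quotW=> Q; rewrite !iso_addE; apply/isoclassP.
apply: linear_iso_trans (linear_iso_sym (fgp_addP _ _)) _.
exact: linear_iso_trans (linear_iso_prodC _ _) (fgp_addP _ _).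
Qed.

Fact iso_add0 : left_id iso_zero iso_add.
Proof.
elim/quotW=> P; rewrite iso_addE; apply/isoclassP.
apply: linear_iso_trans (linear_iso_sym (fgp_addP _ _)) _.
apply: linear_iso_trans (linear_iso_prod0 P).
apply: linear_iso_prod (linear_iso_refl _).
exact: linear_iso_sym (fgproj_reprP _ _).
Qed.

HB.instance Definition _ := GRing.isNmodule.Build isoclass
  iso_addA iso_addC iso_add0.

End IsoClasses.

(* The Grothendieck group of a commutative monoid V, as formal differences.   *)
Section Grothendieck.
Variable V : nmodType.

Definition grothb (p q : V * V) : bool :=
  `[< exists s : V, p.1 + q.2 + s = q.1 + p.2 + s >].

Lemma grothb_refl : reflexive grothb.
Proof. by move=> p; apply/asboolP; exists 0. Qed.

Lemma grothb_sym : symmetric grothb.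
Proof. by move=> p q; apply/asboolP/asboolP => -[s sE]; exists s. Qed.

Lemma grothb_trans : transitive grothb.
Proof.
move=> q p r /asboolP[s sE] /asboolP[t tE]; apply/asboolP.
exists (q.1 + q.2 + s + t).
rewrite [LHS](AC (2*4) ((1*4*5)*(3*2*6)))%AC /= sE tE.
by rewrite [LHS](AC (3*3) ((4*2)*(1*5*3*6)))%AC.
Qed.

Canonical grothb_equiv := EquivRel grothb grothb_refl grothb_sym grothb_trans.

Definition groth := {eq_quot grothb}.
HB.instance Definition _ := Choice.on groth.
HB.instance Definition _ := EqQuotient.on groth.

Lemma grothP (p q : V * V) : \pi_groth p = \pi_groth q <->
  exists s : V, p.1 + q.2 + s = q.1 + p.2 + s.
Proof. by split=> [/eqmodP/asboolP // | pq]; apply/eqmodP/asboolP. Qed.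

Definition groth_add (a b : groth) : groth :=
  \pi_groth ((repr a).1 + (repr b).1, (repr a).2 + (repr b).2).
Definition groth_opp (a : groth) : groth := \pi_groth ((repr a).2, (repr a).1).
Definition groth_zero : groth := \pi_groth (0, 0).

Lemma groth_addE (p q : V * V) : groth_add (\pi_groth p) (\pi_groth q) =
  \pi_groth (p.1 + q.1, p.2 + q.2).
Proof.
have /grothP[s sE] : \pi_groth (repr (\pi_groth p)) = \pi_groth p.
  by rewrite reprK.
have /grothP[t tE] : \pi_groth (repr (\pi_groth q)) = \pi_groth q.
  by rewrite reprK.
apply/grothP; exists (s + t) => /=.
rewrite [LHS](AC (2*2*2) ((1*3*5)*(2*4*6)))%AC /= sE tE.
by rewrite [LHS](AC (3*3) ((1*4)*(2*5)*(3*6)))%AC.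
Qed.

Lemma groth_oppE (p : V * V) : groth_opp (\pi_groth p) = \pi_groth (p.2, p.1).
Proof.
have /grothP[s sE] : \pi_groth (repr (\pi_groth p)) = \pi_groth p.
  by rewrite reprK.
apply/grothP; exists s => /=.
by rewrite [_ + p.1]addrC -sE [_ + p.2]addrC.
Qed.

Fact groth_addA : associative groth_add.
Proof.
elim/quotW=> p; elim/quotW=> q; elim/quotW=> r.
rewrite (groth_addE q r) (groth_addE p q) !groth_addE /=.
by rewrite !addrA.
Qed.
Fact groth_addC : commutative groth_add.
Proof.
elim/quotW=> p; elim/quotW=> q; rewrite !groth_addE.
by rewrite [p.1 + _]addrC [p.2 + _]addrC.
Qed.
Fact groth_add0 : left_id groth_zero groth_add.
Proof. by elim/quotW=> -[a b]; rewrite groth_addE /= !add0r. Qed.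
Fact groth_addN : left_inverse groth_zero groth_opp groth_add.
Proof.
elim/quotW=> p; rewrite groth_oppE groth_addE; apply/grothP; exists 0 => /=.
by rewrite !addr0 add0r addrC.
Qed.

HB.instance Definition _ := GRing.isZmodule.Build groth
  groth_addA groth_addC groth_add0 groth_addN.

Definition to_groth (a : V) : groth := \pi_groth (a, 0).

End Grothendieck.

Definition K0 (R : pzRingType) : zmodType := groth (isoclass R).

Definition K0_class (R : pzRingType) (M : lmodType R) (fgM : fin_generated M)
  (pM : projective M) : K0 R := to_groth (class_of fgM pM).

Definition K0_one (R : pzRingType) : K0 R :=
  K0_class (fin_generated_regular R) (@projective_regular R).

Lemma K0_class_iso (R : pzRingType) (M N : lmodType R)
  (fgM : fin_generated M) (pM : projective M)
  (fgN : fin_generated N) (pN : projective N) :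
  linear_iso M N -> K0_class fgM pM = K0_class fgN pN.
Proof.
move=> MN; congr (to_groth _); apply/isoclassP.
apply: linear_iso_trans (fgproj_reprP fgN pN).
exact: linear_iso_trans (linear_iso_sym (fgproj_reprP fgM pM)) MN.
Qed.

Lemma K0_class_prod (R : pzRingType) (M N : lmodType R)
  (fgM : fin_generated M) (pM : projective M)
  (fgN : fin_generated N) (pN : projective N)
  (fgMN : fin_generated (M * N)%type) (pMN : projective (M * N)%type) :
  K0_class fgMN pMN = K0_class fgM pM + K0_class fgN pN.
Proof.
apply/esym; rewrite [LHS]groth_addE /= [in LHS]addr0; congr (to_groth _).
rewrite [LHS]iso_addE; apply/isoclassP.
apply: linear_iso_trans (linear_iso_sym (fgp_addP _ _)) _.
apply: linear_iso_trans (fgproj_reprP fgMN pMN).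
apply: linear_iso_prod; exact: linear_iso_sym (fgproj_reprP _ _).
Qed.

(* Main.v *)
(* Let m = n - 1 and L = L_n. Every f.g. submodule of a free left L-module is *)
(* free: multiplying generators by long words in the x_i brings them into the *)
(* free algebra spanned by these words, where they reduce to a family whose   *)
(* leading words are not suffixes of one another; such a family is linearly   *)
(* independent, even over L. If it generates L, then its leading words form a *)
(* complete suffix code, so its size is 1 modulo m. Hence L^a = L^b iff       *)
(* a = b mod m (for a, b > 0), and K_0(M_d(L)), generated by the class c of   *)
(* the column module L^d, is Z/m with the class of the ring equal to dc.      *)
(* A pointed isomorphism of K_0's thus yields n = n' and d' = ud mod m with u *)
(* prime to m, so M_d'(L) = M_d(M_u(L)), and it remains to find an            *)
(* isomorphism L -> M_u(L). Such a map, injective because L is simple, comes  *)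
(* from a partition of a forest of u n-ary trees into nu subtrees; with the   *)
(* subtrees arranged along a Sturmian word the map is onto.                   *)

Require Import Defs.
From HB Require Import structures.
From mathcomp Require Import all_boot all_algebra.
From mathcomp Require Import generic_quotient boolp zify.

Set Implicit Arguments.
Unset Strict Implicit.
Unset Printing Implicit Defensive.

Import GRing.Theory.

Local Open Scope ring_scope.

(** In the code n is [k.+2], so everything happens modulo n - 1 = [k.+1]. One direction is
    functoriality: restriction of scalars along an isomorphism carries the regular module to the
    regular module ([alg_iso_K0]).

    For the converse, the row of the y_j and the column of the x_i are mutually inverse, so L^1 and
    L^n are isomorphic. Conversely, [rectinv1_mod] shows that L^a = L^1 forces a = 1 mod n - 1: the
    basis is turned into a reduced family, whose leading words form a complete suffix code over n
    letters. The same reduction makes row spaces over L free ([row_col_free]). Hence every finitely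
    generated projective module over M_d(L) is a sum of column modules, and K_0 is cyclic of order n
    - 1 ([K0_col_eq], [K0_col_gen]). From a pointed isomorphism, [K0_iso_invariants] reads off n and
    a unit u with d u = d' mod n - 1.

    By [alg_iso_flatten] it remains to identify L with M_u(L) ([leavitt_matrix_iso]). The Leavitt
    relations hold in M_u(L) for any numbering of the leaves of a suitable forest, and injectivity
    is [leavitt_simple]. Surjectivity ([mat_generate]) depends on the numbering, which [leaf_exists]
    provides: the leaves that can be moved onto each other within the image should carry the same
    Sturmian letter. *)

Lemma exists_lrmorphism (K : fieldType) (A B : algType K) (f : A -> B) :
  linear f -> monoid_morphism f -> exists g : {lrmorphism A -> B}, g =1 f.
Proof.
move=> flin fmul; pose m1 := GRing.isLinear.Build _ _ _ _ f flin.
pose m2 := GRing.isMonoidMorphism.Build _ _ f fmul.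
pose g : {lrmorphism A -> B} := HB.pack f m1 m2.
by exists g.
Qed.

(** * Words and leading words in Leavitt algebras *)

Section LeavittAlgebra.
Variables (K : fieldType) (k : nat).
Local Notation n := k.+2.
Local Notation L := (leavitt K n).
Local Notation x i := (lv_x K (i : 'I_n)).
Local Notation y i := (lv_y K (i : 'I_n)).
Implicit Types (a b c : L) (u v w : seq 'I_n).

Lemma lv_constE (r : K) : lv_const n r = r%:A :> L.
Proof. by rewrite [RHS]mulr1. Qed.

Lemma leavitt_ind (P : L -> Prop) :
  (forall i, P (x i)) -> (forall i, P (y i)) -> (forall r : K, P r%:A) ->
  (forall a b, P a -> P b -> P (a + b)) ->
  (forall a b, P a -> P b -> P (a * b)) -> forall a, P a.
Proof.
move=> Px Py Pc PD PM; elim/quotW; elim=> [i|i|r|s Ps t Pt|s Ps t Pt].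
- exact: Px.
- exact: Py.
- by have := Pc r; rewrite -lv_constE.
- by rewrite -lv_addE; apply: PD.
- by rewrite -lv_mulE; apply: PM.
Qed.

Section UniversalProperty.
Variables (A : algType K) (X Y : 'I_n -> A).
Hypothesis XY : forall i j, X i * Y j = (i == j)%:R.
Hypothesis YX : \sum_(j < n) Y j * X j = 1.

Fixpoint lv_eval (t : lvterm K n) : A :=
  match t with
  | LvX i => X i
  | LvY i => Y i
  | LvC r => r%:A
  | LvAdd s t => lv_eval s + lv_eval t
  | LvMul s t => lv_eval s * lv_eval t
  end.

Lemma lv_eval_eq s t : lveq s t -> lv_eval s = lv_eval t.
Proof.
elim=> {s t} /=; try by move=> *; congruence.
- by move=> *; rewrite addrA.
- by move=> *; rewrite addrC.
- by move=> t; rewrite scale0r add0r.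
- by move=> t; rewrite scaleN1r mulN1r addNr scale0r.
- by move=> *; rewrite mulrA.
- by move=> *; rewrite scale1r mul1r.
- by move=> *; rewrite mulrDl.
- by move=> *; rewrite mulrDr.
- by move=> *; rewrite scalerDl.
- by move=> *; rewrite mulr_algl scalerA.
- by move=> *; rewrite mulr_algl mulr_algr.
- by move=> i j; rewrite XY; case: (i == j); rewrite ?scale1r ?scale0r.
rewrite scale1r -YX.
elim: (index_enum _) => [|j r IHr]; rewrite ?big_nil ?scale0r //= ?scale0r //.
by rewrite !big_cons /= IHr.
Qed.

Lemma leavitt_lift : exists f : {lrmorphism L -> A},
  (forall i, f (x i) = X i) /\ (forall i, f (y i) = Y i).
Proof.
pose f a := lv_eval (repr a).
have fE t : f (\pi_(leavitt K n) t)%qT = lv_eval t by apply/lv_eval_eq/lv_repr.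
have fM : {morph f : a b / a * b}.
  elim/quotW=> s; elim/quotW=> t; rewrite [_ * _]lv_mulE !fE.
  by [].
have fc (r : K) : f r%:A = r%:A by rewrite -lv_constE fE.
have [||g gE] := @exists_lrmorphism K L A f.
- move=> r a b; rewrite -[r *: a]mulr_algl.
  have fD : {morph f : a b / a + b}.
    by elim/quotW=> s; elim/quotW=> t; rewrite [_ + _]lv_addE !fE.
  by rewrite fD fM fc mulr_algl.
- by split; [rewrite -[1]scale1r fc scale1r | exact: fM].
by exists g; split=> i; rewrite gE fE.
Qed.

End UniversalProperty.

Definition xw w : L := \prod_(i <- w) x i.
Definition yw w : L := \prod_(i <- rev w) y i.

Lemma xw0 : xw [::] = 1. Proof. exact: big_nil. Qed.
Lemma yw0 : yw [::] = 1. Proof. exact: big_nil. Qed.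
Lemma xw_cons i w : xw (i :: w) = x i * xw w. Proof. exact: big_cons. Qed.
Lemma yw_cons i w : yw (i :: w) = yw w * y i.
Proof. by rewrite /yw rev_cons -cats1 big_cat /= big_seq1. Qed.
Lemma xw_cat u w : xw (u ++ w) = xw u * xw w. Proof. exact: big_cat. Qed.
Lemma yw_cat u w : yw (u ++ w) = yw w * yw u.
Proof. by rewrite /yw rev_cat big_cat. Qed.
Lemma xw_rcons w i : xw (rcons w i) = xw w * x i.
Proof. by rewrite -cats1 xw_cat [xw [:: i]]big_seq1. Qed.

Lemma xw_yw w : xw w * yw w = 1.
Proof.
elim: w => [|i w IHw]; first by rewrite xw0 yw0 mulr1.
by rewrite xw_cons yw_cons -mulrA (mulrA (xw w)) IHw mul1r lv_xyE eqxx.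
Qed.

Lemma xw_yw_size u w : size u = size w -> xw u * yw w = (u == w)%:R.
Proof.
elim: u w => [|i u IHu] [|j w] //=; first by rewrite xw_yw.
move=> [/IHu uw]; rewrite xw_cons yw_cons -mulrA (mulrA (xw u)) uw eqseq_cons.
case: (u == w); rewrite ?andbT ?andbF ?mul1r ?lv_xyE //.
by rewrite mul0r mulr0.
Qed.

(** Iterating 1 = sum of the [y i * x i] writes a as the sum of [yw w * (xw w * a)] over the words w
    of length N. *)
Lemma xw_local (P : L -> Prop) N a : P 0 ->
  (forall b c, P b -> P c -> P (b + c)) -> (forall b c, P c -> P (b * c)) ->
  (forall w, size w = N -> P (xw w * a)) -> P a.
Proof.
move=> P0 PD PM; elim: N a => [|N IHN] a Pa.
  by have := Pa [::] erefl; rewrite xw0 mul1r.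
rewrite -[a]mul1r -(lv_yxE K) mulr_suml; apply: (big_ind P) => // i _.
rewrite -mulrA; apply/PM/IHN => w wN.
by rewrite mulrA -xw_rcons; apply: Pa; rewrite size_rcons wN.
Qed.

Lemma xw_separated N a : (forall w, size w = N -> xw w * a = 0) -> a = 0.
Proof.
apply: (@xw_local (fun b => b = 0)) => // [b c -> ->|b c ->]; first exact: addr0.
by rewrite mulr0.
Qed.

(** * Action on functions and the order on words *)

Definition lv_rho a (f : nat -> K) : nat -> K := lv_act (repr a) f.

Lemma lv_rhoE t f : lv_rho (\pi_(leavitt K n) t)%qT f =1 lv_act t f.
Proof. exact/lv_act_eq/lv_repr. Qed.

Lemma lv_rhoM a b f : lv_rho (a * b) f =1 lv_rho a (lv_rho b f).
Proof.
elim/quotW: a => s; elim/quotW: b => t m.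
rewrite [_ * _]lv_mulE !lv_rhoE /=; apply: eq_lv_act => j.
by rewrite lv_rhoE.
Qed.

Lemma lv_rhoD a b f m : lv_rho (a + b) f m = lv_rho a f m + lv_rho b f m.
Proof.
by elim/quotW: a => s; elim/quotW: b => t; rewrite [_ + _]lv_addE !lv_rhoE.
Qed.

Lemma lv_rho_const (r : K) f m : lv_rho r%:A f m = r * f m.
Proof. by rewrite -lv_constE lv_rhoE. Qed.

(** The base n digits [w] written after the number m; the action of [xw w] evaluates a function
    there ([lv_rho_xw]). The leading digit 1 in [wcode] protects zeros, so that comparing codes
    means comparing words by length, then lexicographically. *)
Definition wval m w : nat := foldl (fun m (i : 'I_n) => m * n + i)%N m w.
Definition wcode w : nat := wval 1 w.

Lemma wvalE m w : wval m w = (m * n ^ size w + wval 0 w)%N.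
Proof.
elim: w m => [|i w IHw] m; first by rewrite /wval /= expn0 muln1 addn0.
change (wval (m * n + i) w = m * n ^ (size w).+1 + wval (0 * n + i) w)%N.
by rewrite !(IHw (_ + _)%N) mul0n add0n mulnDl expnS mulnA addnA.
Qed.

Lemma wval0_lt w : (wval 0 w < n ^ size w)%N.
Proof.
elim: w => [//|i w IHw].
change (wval (0 * n + i) w < n ^ (size w).+1)%N.
rewrite wvalE mul0n add0n expnS.
have := ltn_ord i; move: IHw; move: (wval 0 w) (n ^ size w)%N => p q pq iN.
by apply: (@leq_trans (i.+1 * q)); [rewrite mulSn addnC ltn_add2r|
  rewrite leq_mul2r iN orbT].
Qed.

Lemma wval_mono m w v : (0 < m)%N -> (wcode w < wcode v)%N ->
  (wval m w < wval m v)%N.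
Proof.
move=> m0; rewrite /wcode !(wvalE 1) !(wvalE m) !mul1n.
have [szw|szv|->] := ltngtP (size w) (size v); last by rewrite !ltn_add2l.
  move=> _; have := wval0_lt w; have := leq_pexp2l (ltn0Sn k.+1) szw.
  rewrite expnS; move: (wval 0 w) (wval 0 v) (n ^ _)%N (n ^ _)%N => p q r s.
  by nia.
have := wval0_lt v; have := leq_pexp2l (ltn0Sn k.+1) szv.
rewrite expnS; move: (wval 0 w) (wval 0 v) (n ^ _)%N (n ^ _)%N => p q r s.
by nia.
Qed.

Lemma wval_cat m u w : wval m (u ++ w) = wval (wval m u) w.
Proof. exact: foldl_cat. Qed.

Lemma wcode_gt0 w : (0 < wcode w)%N.
Proof. by rewrite /wcode wvalE mul1n addn_gt0 expn_gt0. Qed.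

Lemma wcode_inj : injective wcode.
Proof.
have wr w i : wcode (rcons w i) = (wcode w * n + i)%N.
  by rewrite -cats1 /wcode wval_cat.
have big w i : (1 < wcode (rcons w i))%N.
  by rewrite wr; have := wcode_gt0 w; move: (wcode w) => p; lia.
elim/last_ind=> [|u i IHu] v; case/lastP: v => [//|v j].
- by move=> e; have := big v j; rewrite -e.
- by move=> e; have := big u i; rewrite e.
rewrite !wr => e.
have ij : i = j.
  by apply: ord_inj; have := congr1 (modn^~ n) e; rewrite /= !modnMDl !modn_small.
congr rcons => //; apply: IHu.
by move/eqP: e; rewrite ij eqn_add2r eqn_pmul2r // => /eqP.
Qed.

Lemma wcode_size u w : (wcode u < wcode w)%N -> (size u <= size w)%N.
Proof.
move=> uw; rewrite leqNgt; apply/negP => wu.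
have := leq_pexp2l (ltn0Sn k.+1) wu; move: uw; have := wval0_lt w; rewrite /wcode !(wvalE 1) expnS.
by move: (wval 0 w) (wval 0 u) (n ^ _)%N (n ^ _)%N => p q r s; nia.
Qed.

Lemma lv_rho_xw w f m : lv_rho (xw w) f m = f (wval m w).
Proof.
elim: w m => [|i w IHw] m.
  by rewrite xw0 -[1]scale1r lv_rho_const mul1r.
by rewrite xw_cons lv_rhoM lv_rhoE /= IHw.
Qed.

(* The coefficient of [xw w] in a combination of the [xw _]; extended to all  *)
(* of [L] through the action on functions.                                    *)
Definition lv_coef w a : K := lv_rho a (fun m => (m == wcode w)%:R) 1%N.

Lemma lv_coef_xw u w : lv_coef w (xw u) = (u == w)%:R.
Proof. by rewrite /lv_coef lv_rho_xw (inj_eq wcode_inj). Qed.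

Lemma lv_coefD w a b : lv_coef w (a + b) = lv_coef w a + lv_coef w b.
Proof. exact: lv_rhoD. Qed.

Lemma lv_coefZ w (r : K) a : lv_coef w (r *: a) = r * lv_coef w a.
Proof. by rewrite /lv_coef -mulr_algl lv_rhoM lv_rho_const. Qed.

Lemma lv_coef0 w : lv_coef w 0 = 0.
Proof. by rewrite -(scale0r (0 : L)) lv_coefZ mul0r. Qed.

Lemma lv_coef_sum w (T : finType) (P : pred T) (F : T -> L) :
  lv_coef w (\sum_(t | P t) F t) = \sum_(t | P t) lv_coef w (F t).
Proof. exact: (big_morph _ (lv_coefD w) (lv_coef0 w)). Qed.

(** * Leading words in the free algebra on the x_i *)

Inductive low (N : nat) : L -> Prop :=
| low_zero : low N 0
| low_add (r : K) w a :
    (wcode w < N)%N -> low N a -> low N (r *: xw w + a).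

Lemma lowD N a b : low N a -> low N b -> low N (a + b).
Proof.
move=> la lb; elim: la => [|r w a' wN _ IH]; first by rewrite add0r.
by rewrite -addrA; apply: low_add.
Qed.

Lemma lowZ N (r : K) a : low N a -> low N (r *: a).
Proof.
elim=> [|s w b wN _ IH]; first by rewrite scaler0; apply: low_zero.
by rewrite scalerDr scalerA; apply: low_add.
Qed.

Lemma lowN N a : low N a -> low N (- a).
Proof. by rewrite -scaleN1r; apply: lowZ. Qed.

Lemma low_xw N w : (wcode w < N)%N -> low N (xw w).
Proof.
move=> wN; rewrite -[xw w]scale1r -[X in low _ X]addr0.
exact/low_add/low_zero.
Qed.

Lemma low_trans N M a : (N <= M)%N -> low N a -> low M a.
Proof.
move=> NM; elim=> [|r w b wN _ IH]; first exact: low_zero.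
by apply: low_add => //; apply: leq_trans NM.
Qed.

Lemma low0 a : low 0 a -> a = 0. Proof. by case. Qed.

Lemma lv_coef_low w a : low (wcode w) a -> lv_coef w a = 0.
Proof.
elim=> [|r u b uw _ IH]; first exact: lv_coef0.
rewrite lv_coefD lv_coefZ IH lv_coef_xw addr0.
by case: eqP uw => [->|]; rewrite ?ltnn // mulr0.
Qed.

Definition lead a w : Prop :=
  exists (r : K) b, [/\ r != 0, low (wcode w) b & a = r *: xw w + b].

Lemma lowS N a : low N.+1 a -> low N a \/ exists2 w, lead a w & wcode w = N.
Proof.
suff S a' : low N.+1 a' -> low N a' \/ exists w (r : K) b,
    [/\ wcode w = N, low (wcode w) b & a' = r *: xw w + b].
  case/S=> [|[w [r [b [wN lb aE]]]]]; first by left.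
  have [r0|r0] := eqVneq r 0; last by right; exists w => //; exists r, b.
  by left; rewrite aE r0 scale0r add0r -wN.
elim=> [|r w b wN _ [lb|[u [s [d [uN ld bE]]]]]]; first by left; apply: low_zero.
  move: wN; rewrite ltnS leq_eqVlt => /orP[/eqP wN|wN]; last by left; apply: low_add.
  by right; exists w, r, b; rewrite wN.
right; move: wN; rewrite ltnS leq_eqVlt => /orP[/eqP wN|wN]; last first.
  exists u, s, (r *: xw w + d); split=> //; last by rewrite bE addrCA.
  by apply: low_add => //; rewrite uN.
have wu : w = u by apply: wcode_inj; rewrite uN.
by exists u, (r + s), d; split=> //; rewrite bE wu addrA -scalerDl.
Qed.

Lemma low_lead N a : low N a -> a = 0 \/ exists2 w, lead a w & (wcode w < N)%N.
Proof.
elim: N => [|N IHN]; first by move/low0; left.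
case/lowS => [/IHN[|[w lw wN]]|[w lw wN]]; first by left.
  by right; exists w => //; apply: ltnW.
by right; exists w; rewrite ?wN.
Qed.

Lemma lead_low a w : lead a w -> low (wcode w).+1 a.
Proof.
by case=> r [b [_ lb ->]]; apply: low_add => //; apply: low_trans lb.
Qed.

Lemma lead_coef_neq0 a w : lead a w -> lv_coef w a != 0.
Proof.
case=> r [b [r0 lb ->]].
by rewrite lv_coefD lv_coefZ lv_coef_xw eqxx mulr1 lv_coef_low // addr0.
Qed.

Lemma low_mull u w b : low (wcode w) b -> low (wcode (u ++ w)) (xw u * b).
Proof.
elim=> [|r v d vw _ IH]; first by rewrite mulr0; apply: low_zero.
rewrite mulrDr -scalerAr -xw_cat; apply: low_add => //.
by rewrite /wcode !wval_cat; apply: wval_mono => //; apply: wcode_gt0.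
Qed.

Lemma wcode_catl u v w :
  (wcode u < wcode v)%N -> (wcode (u ++ w) < wcode (v ++ w))%N.
Proof.
rewrite /wcode !wval_cat => uv.
by rewrite (wvalE (wval 1 u)) (wvalE (wval 1 v)) ltn_add2r ltn_pmul2r ?expn_gt0.
Qed.

Lemma low_mul u w a b : low (wcode u) a -> low (wcode w).+1 b ->
  low (wcode (u ++ w)) (a * b).
Proof.
move=> la lb; elim: la => [|r v d vu _ IH]; first by rewrite mul0r; apply: low_zero.
rewrite mulrDl; apply: lowD IH; rewrite -scalerAl; apply: lowZ.
elim: lb => [|s t e tw _ IH]; first by rewrite mulr0; apply: low_zero.
rewrite mulrDr -scalerAr -xw_cat; apply: low_add => //.
apply: leq_ltn_trans (wcode_catl w vu); move: tw; rewrite ltnS leq_eqVlt.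
case/orP => [/eqP/wcode_inj -> //|tw].
by apply: ltnW; rewrite /wcode !wval_cat; apply: wval_mono => //; apply: wcode_gt0.
Qed.

(** The order on words is compatible with concatenation on both sides ([low_mull], [low_mul]), so
    nothing cancels the product of the leading terms. *)
Lemma lead_mul a b u w : lead a u -> lead b w -> lead (a * b) (u ++ w).
Proof.
case=> r [d [r0 ld ->]] lb; have lb1 := lead_low lb.
case: lb lb1 => s [e [s0 le ->]] lb1.
exists (r * s), (r *: xw u * e + d * (s *: xw w + e)); split.
- by rewrite mulf_neq0.
- by apply: lowD; [rewrite -scalerAl; apply/lowZ/low_mull|apply: low_mul].
rewrite [LHS]mulrDl mulrDr -addrA; congr (_ + _).
by rewrite -scalerAl -scalerAr -xw_cat scalerA.
Qed.

Definition xpoly a : Prop := exists N, low N a.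

Lemma xpolyD a b : xpoly a -> xpoly b -> xpoly (a + b).
Proof.
move=> [N lN] [M lM]; exists (maxn N M).
by apply: lowD; [apply: low_trans lN|apply: low_trans lM];
  rewrite ?leq_maxl ?leq_maxr.
Qed.

Lemma xpolyZ (r : K) a : xpoly a -> xpoly (r *: a).
Proof. by case=> N lN; exists N; apply: lowZ. Qed.

Lemma xpoly_xw w : xpoly (xw w).
Proof. by exists (wcode w).+1; apply: low_xw. Qed.

Lemma xpoly0 : xpoly 0. Proof. by exists 0%N; apply: low_zero. Qed.

Lemma xpoly_ind (P : L -> Prop) : P 0 ->
  (forall (r : K) w a, P a -> P (r *: xw w + a)) -> forall a, xpoly a -> P a.
Proof. by move=> P0 PD a [N]; elim=> // r w b _ _; apply: PD. Qed.

Lemma xpolyM a b : xpoly a -> xpoly b -> xpoly (a * b).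
Proof.
move=> pa pb; elim/xpoly_ind: pa => [|r w d IH].
  by rewrite mul0r; apply: xpoly0.
rewrite mulrDl; apply: xpolyD IH; rewrite -scalerAl; apply: xpolyZ.
elim/xpoly_ind: pb => [|s v e IH]; first by rewrite mulr0; apply: xpoly0.
by rewrite mulrDr -scalerAr -xw_cat; apply: xpolyD IH; apply/xpolyZ/xpoly_xw.
Qed.

(** A letter of the word absorbs each y. For a product a * b, the end of the word absorbs the y's of
    a; the first M letters still stand in front of the resulting words and absorb those of b. *)
Lemma xpoly_shift a : exists N, forall w, (N <= size w)%N -> xpoly (xw w * a).
Proof.
elim/leavitt_ind: a => [i|i|r|a b [N aN] [M bM]|a b [N aN] [M bM]].
- exists 0%N => w _; apply: xpolyM; first exact: xpoly_xw.
  by have := xpoly_xw [:: i]; rewrite xw_cons xw0 mulr1.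
- exists 1%N => w; case/lastP: w => [//|w j] _.
  rewrite xw_rcons -mulrA lv_xyE; case: (j == i); last first.
    by rewrite mulr0; apply: xpoly0.
  by rewrite mulr1; apply: xpoly_xw.
- exists 0%N => w _; rewrite -scalerAr mulr1; apply/xpolyZ/xpoly_xw.
- exists (maxn N M) => w; rewrite geq_max => /andP[wN wM].
  by rewrite mulrDr; apply: xpolyD; [apply: aN|apply: bM].
exists (M + N)%N => w sw; rewrite -(cat_take_drop M w) xw_cat mulrA.
have sM : size (take M w) = M by rewrite size_takel //; apply: leq_trans (leq_addr _ _) sw.
have : xpoly (xw (drop M w) * a) by apply: aN; rewrite size_drop; lia.
rewrite -(mulrA (xw _)); move: (_ * a) => d; elim/xpoly_ind=> [|r v e IH].
  by rewrite mulr0 mul0r; apply: xpoly0.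
rewrite mulrDr mulrDl; apply: xpolyD IH; rewrite -scalerAr -scalerAl.
by apply: xpolyZ; rewrite -xw_cat; apply: bM; rewrite size_cat sM leq_addr.
Qed.

Lemma xpoly_shift_fin (T : finType) (a : T -> L) :
  exists N, forall w t, (N <= size w)%N -> xpoly (xw w * a t).
Proof.
have /choice[N NP] t := xpoly_shift (a t).
exists (\max_t N t)%N => w t Nw; apply: NP; apply: leq_trans Nw.
exact: leq_bigmax.
Qed.

End LeavittAlgebra.

(** * Submodules of free modules *)

Definition rectinv (R : pzRingType) (a b : nat) : Prop :=
  exists (P : 'M[R]_(a, b)) (Q : 'M[R]_(b, a)), P *m Q = 1%:M /\ Q *m P = 1%:M.

Lemma suffix_comparable (T : eqType) (u u' w w' : seq T) :
  u ++ w = u' ++ w' -> (size w <= size w')%N -> suffix w w'.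
Proof.
move=> e sw; apply/suffixP; exists (take (size w' - size w) w').
rewrite -{1}(cat_take_drop (size w' - size w) w'); congr (_ ++ _).
have -> : w' = drop (size u') (u ++ w) by rewrite e drop_size_cat.
rewrite drop_drop -[RHS](drop_size_cat w (erefl (size u))) size_drop.
congr (drop _ _); have := congr1 size e; rewrite !size_cat; lia.
Qed.

Lemma sum_enum_val (V : pzSemiRingType) (T : finType) (F : T -> V) :
  \sum_t F t = \sum_(i < #|T|) F (enum_val i).
Proof. by rewrite (reindex _ (onW_bij _ (@enum_val_bij T))). Qed.

Section Ideals.
Variables (K : fieldType) (k : nat).
Local Notation n := k.+2.
Local Notation L := (leavitt K n).
Implicit Types (a b c : L) (u v w : seq 'I_n).

Definition lspan (T : finType) (e : T -> L) a : Prop :=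
  exists c : T -> L, a = \sum_t c t * e t.

Definition lindep (T : finType) (e : T -> L) : Prop :=
  forall c : T -> L, \sum_t c t * e t = 0 -> forall t, c t = 0.

Section Span.
Variables (T : finType) (e : T -> L).

Lemma lspan0 : lspan e 0.
Proof. by exists (fun=> 0); rewrite big1 // => t _; rewrite mul0r. Qed.

Lemma lspanD a b : lspan e a -> lspan e b -> lspan e (a + b).
Proof.
case=> c -> [d ->]; exists (fun t => c t + d t).
by rewrite -big_split; apply: eq_bigr => t _ /=; rewrite mulrDl.
Qed.

Lemma lspanM a b : lspan e b -> lspan e (a * b).
Proof.
case=> c ->; exists (fun t => a * c t).
by rewrite mulr_sumr; apply: eq_bigr => t _; rewrite mulrA.
Qed.

Lemma lspan_gen t : lspan e (e t).
Proof.
exists (fun s => (s == t)%:R); rewrite (bigD1 t) //= eqxx mul1r.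
by rewrite big1 ?addr0 // => s /negPf ->; rewrite mul0r.
Qed.

Lemma lspan_trans (S : finType) (f : S -> L) a :
  lspan e a -> (forall t, lspan f (e t)) -> lspan f a.
Proof.
case=> c -> ef; apply: (big_ind (lspan f)); first last.
- by move=> t _; have [d ->] := ef t; exists (fun s => c t * d s);
    rewrite mulr_sumr; apply: eq_bigr => s _; rewrite mulrA.
- move=> _ _ [d ->] [d' ->]; exists (fun s => d s + d' s).
  by rewrite -big_split; apply: eq_bigr => s _ /=; rewrite mulrDl.
by exists (fun=> 0); rewrite big1 // => s _; rewrite mul0r.
Qed.

Lemma lindep_neq0 : lindep e -> forall t, e t != 0.
Proof.
move=> ie t; apply/eqP => et0.
have := ie (fun s => (s == t)%:R); rewrite (bigD1 t) //= et0 mulr0.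
rewrite big1 ?addr0 => [/(_ erefl t)/eqP|s /negPf ->]; last by rewrite mul0r.
by rewrite eqxx oner_eq0.
Qed.

End Span.

Definition transv (T : finType) (e : T -> L) (s t : T) (q : L) : T -> L :=
  fun z => if z == t then e t - q * e s else e z.

Lemma transv_span (T : finType) (e : T -> L) s t q z :
  lspan e (transv e s t q z).
Proof.
rewrite /transv; case: ifP => _; last exact: lspan_gen.
rewrite -mulNr; apply: lspanD; first exact: lspan_gen.
exact/lspanM/lspan_gen.
Qed.

Lemma transvK (T : finType) (e : T -> L) s t q : s != t ->
  transv (transv e s t q) s t (- q) =1 e.
Proof.
move=> /negPf st z; rewrite /transv eqxx st mulNr opprK subrK.
by case: eqP => // ->.
Qed.

Lemma span_transv (T : finType) (e : T -> L) s t q z : s != t ->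
  lspan (transv e s t q) (e z).
Proof. by move=> st; rewrite -(transvK e q st); apply: transv_span. Qed.

Lemma lindep_transv (T : finType) (e : T -> L) s t q : s != t ->
  lindep e -> lindep (transv e s t q).
Proof.
move=> st ie c c0; pose c' z := if z == s then c s - c t * q else c z.
have E : \sum_z c' z * e z = 0.
  apply: etrans c0; rewrite (bigD1 s) //= [RHS](bigD1 s) //=.
  rewrite (bigD1 t) 1?eq_sym //= [X in _ = _ + X](bigD1 t) 1?eq_sym //=.
  rewrite /c' /transv eqxx (negPf st) eq_sym (negPf st) eqxx.
  rewrite mulrBl mulrBr mulrA -!addrA; congr (_ + _).
  rewrite addrCA; congr (_ + (_ + _)).
  by apply: eq_bigr => z /andP[/negPf -> /negPf ->].
have c'0 := ie _ E.
have c0' z : z != s -> c z = 0 by have := c'0 z; rewrite /c' => + /negPf => + zs; rewrite zs.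
move=> z; have [->|/c0' //] := eqVneq z s.
by have := c'0 s; rewrite /c' eqxx (c0' t) 1?eq_sym // mul0r subr0.
Qed.

(** * Reduced families *)

Definition reduced (T : finType) (g : T -> L) (w : T -> seq 'I_n) : Prop :=
  (forall t, lead (g t) (w t)) /\
  (forall s t, s != t -> ~~ suffix (w s) (w t)).

(* Buchberger-like reduction with the order on words given by their codes; a  *)
(* vanishing element is kept in the family, whose index type thus stays fixed.*)
Lemma reduce_xpoly (T : finType) (e : T -> L) (N : T -> nat) :
  (forall t, low (N t) (e t)) ->
  exists (g : T -> L) (w : T -> seq 'I_n),
  [/\ forall t, lspan g (e t), forall t, lspan e (g t), lindep e -> lindep g,
      forall t, g t != 0 -> lead (g t) (w t) &
      forall s t, s != t -> g s != 0 -> g t != 0 -> ~~ suffix (w s) (w t)].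
Proof.
have [m] := ubnP (\sum_t N t)%N; elim: m => // m IHm in e N * => Nm lN.
pose N' t z := if z == t then (N t).-1 else N z.
have N'm t : (0 < N t)%N -> (\sum_z N' t z < m)%N.
  move=> Nt; rewrite -ltnS; apply: leq_trans Nm; rewrite ltnS.
  rewrite (bigD1 t) //= [X in (_ < X)%N](bigD1 t) //=.
  rewrite /N' eqxx -(ltn_predK Nt) /= addSn ltnS leq_add2l leq_eqVlt.
  by apply/orP; left; apply/eqP/eq_bigr => z /negPf ->.
(* The measure is the sum of the bounds [N t]. Once no bound can be lowered, each nonzero [e t] has
   a leading word of code [(N t).-1]. *)
have [[t [Nt lt]]|nolow] := pselect (exists t, (0 < N t)%N /\ low (N t).-1 (e t)).
  apply: (IHm e (N' t)) => [|z]; first exact: N'm.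
  by rewrite /N'; case: eqP => [->|].
have /choice[w wP] t : exists w, e t != 0 -> lead (e t) w /\ (wcode w).+1 = N t.
  have := lN t; case Nt : (N t) => [|p].
    by move/low0 => ->; exists [::]; rewrite eqxx.
  case/lowS => [lt|[w lw wp]]; last by exists w; rewrite wp.
  by case: nolow; exists t; rewrite Nt.
have [[s [t [st s0 t0 /suffixP[u wt]]]]|nosuf] := pselect (exists s t,
  [/\ s != t, e s != 0, e t != 0 & suffix (w s) (w t)]); last first.
  exists e, w; split=> [t|t|//|t /wP[]//|s t st s0 t0].
  - exact: lspan_gen.
  - exact: lspan_gen.
  by apply/negP => suf; apply: nosuf; exists s, t.
have [[r [b [r0 lb rE]]] ws] := wP s s0.
have [[r' [b' [r'0 lb' r'E]]] wt'] := wP t t0.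
(* As [w t = u ++ w s], subtracting [q * e s] cancels the leading term of [e t], which lowers the
   bound at t. *)
pose q := (r' / r) *: xw K u.
have lowt : low (N t).-1 (e t - q * e s).
  rewrite -wt' /= r'E rE /q -scalerAl mulrDr scalerDr -scalerAr scalerA.
  rewrite divfK // -xw_cat -wt opprD addrACA subrr add0r.
  apply: lowD => //; apply/lowN/lowZ; rewrite wt; exact: low_mull.
have [|z|g [v [eg ge ig gv suf]]] := IHm (transv e s t q) (N' t).
- by apply: N'm; rewrite -wt'.
- by rewrite /N' /transv; case: eqP.
exists g, v; split=> // [z|z|ie].
- exact: lspan_trans (span_transv e q z st) eg.
- by apply: lspan_trans (ge z) _ => y; apply: transv_span.
- exact/ig/lindep_transv.
Qed.

Lemma expn_mod1 N : n ^ N = 1 %[mod k.+1]%N.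
Proof. by rewrite -modnXm -addn1 modnDl modnXm exp1n. Qed.

(** Each [e t] is replaced by its n^N products with the words of length N, polynomials for large N.
    They span the same submodule, stay independent if the [e t] are, and n^N = 1 mod n - 1. After
    reduction the zeros are dropped; an independent family has none. *)
Lemma reduced_family (T : finType) (e : T -> L) :
  exists (S : finType) (g : S -> L) (w : S -> seq 'I_n),
  [/\ reduced g w, forall t, lspan g (e t), forall s, lspan e (g s) &
      lindep e -> #|S| = #|T| %[mod k.+1]%N].
Proof.
have [N xpN] := xpoly_shift_fin e.
pose e1 (z : T * N.-tuple 'I_n) := xw K z.2 * e z.1.
have /choice[M lM] z : exists M, low M (e1 z).
  by apply: xpN; rewrite size_tuple.
have e1e z : lspan e (e1 z) by apply/lspanM/lspan_gen.
have ee1 t : lspan e1 (e t).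
  apply: (@xw_local _ _ _ N) => [|b c|b c|w /eqP wN].
  - exact: lspan0.
  - exact: lspanD.
  - exact: lspanM.
  exact: (lspan_gen e1 (t, Tuple wN)).
have ie1 : lindep e -> lindep e1.
  move=> ie c c0 [t J].
  have E : \sum_(t : T) (\sum_(I : N.-tuple 'I_n) c (t, I) * xw K I) * e t = 0.
    apply: etrans c0; rewrite (eq_bigr (fun t => \sum_I c (t, I) * e1 (t, I))).
      by rewrite pair_bigA; apply: eq_bigr => -[].
    move=> s _; rewrite mulr_suml; apply: eq_bigr => I _.
    by rewrite mulrA.
  have := congr1 (fun a => a * yw K J) (ie _ E t).
  rewrite mul0r mulr_suml (bigD1 J) //= -mulrA xw_yw mulr1 big1 ?addr0 // => I IJ.
  rewrite -mulrA xw_yw_size ?size_tuple //.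
  by rewrite (inj_eq val_inj) (negPf IJ) mulr0.
have [g [w [e1g ge1 ig gw suf]]] := reduce_xpoly lM.
exists {z | g z != 0}, (g \o val), (w \o val); split.
- split=> [[z z0]|[s s0] [t t0] st] /=; first exact: gw.
  exact: suf.
- move=> t; apply: lspan_trans (ee1 t) _ => z; apply: lspan_trans (e1g z) _ => y.
  have [->|y0] := eqVneq (g y) 0; first exact: lspan0.
  exact: (lspan_gen (g \o val) (Sub y y0 : {z | g z != 0})).
- by move=> s; apply: lspan_trans (ge1 _) e1e.
move=> ie; have gn0 := lindep_neq0 (ig (ie1 ie)).
rewrite card_sig (eq_card (B := predT)); last by move=> z; rewrite !inE gn0.
rewrite card_prod card_tuple card_ord -modnMmr expn_mod1.
by rewrite modnMmr muln1.
Qed.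

Section Reduced.
Variables (T : finType) (g : T -> L) (w : T -> seq 'I_n).
Hypothesis gw : reduced g w.

(** The nonzero terms have leading words [u t ++ w t]. If two of these agreed, one of [w s], [w t]
    would be a suffix of the other; so they are distinct and the largest one survives in the sum. *)
Lemma reduced_sum (a : T -> L) t0 : (forall t, xpoly (a t)) -> a t0 != 0 ->
  exists t u, lv_coef (u ++ w t) (\sum_t a t * g t) != 0.
Proof.
move=> xa at0; have [lg suf] := gw.
have /choice[u uP] t : exists u, a t != 0 -> lead (a t) u.
  have [N lN] := xa t; have [->|[v lv _]] := low_lead lN; last by exists v.
  by exists [::]; rewrite eqxx.
have lag t : a t != 0 -> lead (a t * g t) (u t ++ w t).
  by move=> /uP la; apply: lead_mul.
case: (@arg_maxnP _ t0 (fun t => a t != 0) (fun t => wcode (u t ++ w t)) at0).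
move=> t ta0 tmax; exists t, (u t).
rewrite (bigD1 t) //= lv_coefD lv_coef_sum big1 ?addr0 => [|s st].
  exact/lead_coef_neq0/lag.
have [->|sa0] := eqVneq (a s) 0; first by rewrite mul0r lv_coef0.
apply: lv_coef_low; apply: low_trans (lead_low (lag s sa0)).
have := tmax s sa0; rewrite /= (leq_eqVlt (wcode (u s ++ w s))) => /orP[/eqP/wcode_inj e|//].
have [sw|/ltnW sw] := leqP (size (w s)) (size (w t)).
  by have := suf s t st; rewrite (suffix_comparable e sw).
have := suf t s; rewrite eq_sym => /(_ st).
by rewrite (suffix_comparable (esym e) sw).
Qed.

(** If [a t] is nonzero, some long word v has [xw v * a t] nonzero, and all coefficients become
    polynomials after multiplication by it. *)
Lemma reduced_indep : lindep g.
Proof.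
move=> a a0 t; have [N xN] := xpoly_shift_fin a.
apply: (@xw_separated _ _ N) => v vN; apply/eqP/negPn/negP => va0.
have [s|s [u]] := @reduced_sum (fun s => xw K v * a s) t _ va0.
  by apply: xN; rewrite vN.
suff -> : \sum_t xw K v * a t * g t = 0 by rewrite lv_coef0 eqxx.
rewrite -[RHS](mulr0 (xw K v)) -[X in _ = _ * X]a0 mulr_sumr.
by apply: eq_bigr => z _; rewrite mulrA.
Qed.

(** For a long word v, [xw v = xw v * 1] is a combination of the [g t] with polynomial coefficients.
    The word that [reduced_sum] finds in it can only be v. *)
Lemma reduced_complete : lspan g 1 ->
  exists N, forall v, (N <= size v)%N -> exists t, suffix (w t) v.
Proof.
case=> a a1; have [N xN] := xpoly_shift_fin a; exists N => v vN.
have vE : xw K v = \sum_t xw K v * a t * g t.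
  rewrite -[LHS]mulr1 a1 mulr_sumr; by apply: eq_bigr => z _; rewrite mulrA.
have [all0|] := boolP [forall t, xw K v * a t == 0].
  have := lv_coef_xw K v v; rewrite eqxx vE big1 ?lv_coef0 => [/esym/eqP|t _].
    by rewrite oner_eq0.
  by rewrite (eqP (forallP all0 t)) mul0r.
rewrite negb_forall => /existsP[t va0].
have [s|s [u]] := @reduced_sum (fun s => xw K v * a s) t _ va0; first exact: xN.
rewrite -vE lv_coef_xw; case: (v =P _) => [->|_]; last by rewrite eqxx.
by move=> _; exists s; apply: suffix_suffix.
Qed.

End Reduced.

(** * Counting in complete suffix codes *)

Fixpoint allwords (N : nat) : seq (seq 'I_n) :=
  if N is N'.+1 then [seq i :: v | i <- enum 'I_n, v <- allwords N']
  else [:: [::]].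

Lemma mem_allwords N v : (v \in allwords N) = (size v == N).
Proof.
elim: N v => [|N IHN] [|i v] //=; first by apply/negbTE/negP => /allpairsP[[? ?] []].
apply/allpairsP/idP => [[[j u] /= [_ + [_ ->]]]|]; first by rewrite IHN.
by rewrite eqSS -IHN => vN; exists (i, v); rewrite mem_enum.
Qed.

Lemma uniq_allwords N : uniq (allwords N).
Proof.
elim: N => //= N IHN; apply: allpairs_uniq; rewrite ?enum_uniq //.
by move=> [i v] [j u] _ _ /= e; congr (_, _); case: e.
Qed.

Lemma size_allwords N : size (allwords N) = (n ^ N)%N.
Proof. by elim: N => //= N IHN; rewrite size_allpairs IHN size_enum_ord expnS. Qed.

Lemma count_suffix v N : count (suffix v) (allwords (N + size v)) = (n ^ N)%N.
Proof.
elim: N => [|N IHN].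
  rewrite add0n (@eq_in_count _ _ (pred1 v)) => [|u].
    by rewrite count_uniq_mem ?uniq_allwords // mem_allwords eqxx.
  rewrite mem_allwords => /eqP uv; apply/suffixP/eqP => [[[|i u'] e]|->] //.
    by move: uv; rewrite e /= size_cat => /eqP; rewrite -addSn -{2}[size v]add0n eqn_add2r.
  by exists [::].
rewrite expnS -IHN addSn /= count_flatten -map_comp sumnE big_map big_enum /=.
rewrite (eq_bigr (fun=> count (suffix v) (allwords (N + size v)))).
  by rewrite sum_nat_const card_ord.
move=> i _; rewrite /= count_map; apply: eq_in_count => u.
rewrite mem_allwords => /eqP uN /=; apply/idP/idP; last exact: (suffix_catr [:: i]).
case/suffixP=> [[|j u'] e]; last by case: e => _ ->; apply: suffix_suffix.
by have := congr1 size e => /=; rewrite uN; lia.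
Qed.

(** Each word of a large length M has exactly one suffix in the code, so the n^(M - |w t|) sum up to
    n^M. All these powers are 1 mod n - 1. *)
Lemma complete_code_card (T : finType) (w : T -> seq 'I_n) N :
  (forall s t, s != t -> ~~ suffix (w s) (w t)) ->
  (forall v, (N <= size v)%N -> exists t, suffix (w t) v) ->
  #|T| = 1 %[mod k.+1]%N.
Proof.
move=> suf cpl; pose M := (N + \sum_t size (w t))%N.
have wM t : (size (w t) <= M)%N.
  by rewrite /M (bigD1 t) //= addnCA leq_addr.
have : (\sum_(v <- allwords M) \sum_t (suffix (w t) v : nat) = n ^ M)%N.
  rewrite -size_allwords -sum1_size; apply: eq_big_seq => v.
  rewrite mem_allwords => /eqP vM.
  have [|t tv] := cpl v; first by rewrite vM leq_addr.
  rewrite (bigD1 t) //= tv big1 ?addn0 // => s st.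
  apply/eqP; rewrite eqb0; apply/negP => sv.
  have [[u1 e1] [u2 e2]] := (suffixP tv, suffixP sv).
  have e : u1 ++ w t = u2 ++ w s by rewrite -e1 -e2.
  have [sw|/ltnW sw] := leqP (size (w s)) (size (w t)).
    by have := suf s t st; rewrite (suffix_comparable (esym e) sw).
  have := suf t s; rewrite eq_sym => /(_ st).
  by rewrite (suffix_comparable e sw).
rewrite exchange_big /=.
rewrite (eq_bigr (fun t => n ^ (M - size (w t)))%N) => [E|t _]; last first.
  rewrite -(count_suffix (w t)) subnK // -sum1_count [RHS]big_mkcond.
  by apply: eq_bigr => v _; case: suffix.
rewrite -(expn_mod1 M) -E -sum1_card; elim/big_ind2: _ => // [p p' q q' pp qq|t _].
  by rewrite -modnDm pp qq modnDm.
by rewrite expn_mod1.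
Qed.

(** The entries of the column P form a basis of L: PQ = 1 makes them independent, QP = 1 makes them
    generate. The corresponding reduced family has a complete code of leading words. *)
Lemma rectinv1_mod (a : nat) : rectinv L a 1 -> a = 1 %[mod k.+1]%N.
Proof.
case=> P [Q [PQ QP]]; pose e (t : 'I_a) := P t 0.
have [S [g [w [gw eg ge card]]]] := reduced_family e.
rewrite -(card_ord a) -card => [|c c0 t].
  have [|N cpl] := reduced_complete gw; last first.
    by case: gw => _ suf; apply: complete_code_card suf cpl.
  apply: lspan_trans eg; exists (Q 0).
  by have := congr1 (fun A : 'M_1 => A 0 0) QP; rewrite !mxE.
have cP : (\row_j c j) *m P = 0.
  by apply/matrixP=> i j; rewrite !mxE (ord1 j); apply: etrans c0; apply: eq_bigr => z _; rewrite !mxE.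
have := congr1 (fun A => (A *m Q) 0 t) cP.
by rewrite -mulmxA PQ mulmx1 mul0mx !mxE.
Qed.

(** * Simplicity of L and freeness of row spaces *)

Lemma xw_yw_drop (u v : seq 'I_n) : (size u <= size v)%N ->
  drop (size v - size u) v != u -> xw K u * yw K v = 0 /\ xw K v * yw K u = 0.
Proof.
move=> uv dv; have sd : size (drop (size v - size u) v) = size u.
  by rewrite size_drop subKn.
rewrite -(cat_take_drop (size v - size u) v) yw_cat xw_cat; split.
  by rewrite mulrA xw_yw_size // eq_sym (negPf dv) mul0r.
by rewrite -mulrA xw_yw_size // (negPf dv) mulr0.
Qed.

Let stop (M : nat) : seq 'I_n := 0 :: nseq M 1.

(* A word [0 1 ... 1] followed by a short word determines the latter from     *)
(* the right.                                                                 *)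
Lemma xw_yw_stop M u v : u != v -> (size u <= M)%N -> (size v <= M)%N ->
  xw K (stop M ++ u) * yw K (stop M ++ v) = 0.
Proof.
move=> uv uM vM.
suff drop_stop w w' : (size w < size w' <= M)%N ->
    drop (size (stop M ++ w') - size (stop M ++ w)) (stop M ++ w') != stop M ++ w.
  have [suv|suv|suv] := ltngtP (size u) (size v).
  - apply: (proj1 (@xw_yw_drop _ _ _ _)); last by apply: drop_stop; rewrite suv.
    by rewrite !size_cat leq_add2l ltnW.
  - apply: (proj2 (@xw_yw_drop _ _ _ _)); last by apply: drop_stop; rewrite suv.
    by rewrite !size_cat leq_add2l ltnW.
  by rewrite xw_yw_size ?eqseq_cat ?eqxx ?(negPf uv) // !size_cat suv.
case/andP=> ww wM; rewrite !size_cat subnDl; apply/eqP => /(congr1 (nth 0 ^~ 0%N)).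
rewrite nth_drop addn0 nth_cat /= size_nseq.
have -> : (size w' - size w < M.+1)%N by lia.
rewrite -(@prednK (size w' - size w)) ?subn_gt0 //= nth_nseq.
have -> : ((size w' - size w).-1 < M)%N by lia.
by move/eqP; rewrite oner_eq0.
Qed.

(** Some word v makes [xw v * a] a nonzero polynomial with leading word w. A stop word put in front
    separates w from the smaller words, none of which is longer than w, so [yw (stop _ ++ w)] on the
    right kills all but the leading term. *)
Lemma leavitt_simple a : a != 0 -> exists b c, b * a * c = 1.
Proof.
move=> a0; have [N xN] := xpoly_shift a.
have [v [vN va0]] : exists v, size v = N /\ xw K v * a != 0.
  apply/not_existsP => no; case/eqP: a0; apply: (@xw_separated _ _ N) => v vN.
  by apply/eqP/negPn/negP => va0; apply: (no v).
have [|M lM] := xN v; first by rewrite vN.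
have [/eqP|[w [r [d [r0 ld E]]] _]] := low_lead lM; first by rewrite (negPf va0).
exists (r^-1 *: (xw K (stop (size w)) * xw K v)), (yw K (stop (size w) ++ w)).
rewrite -!scalerAl -(mulrA _ _ a) E mulrDr mulrDl -scalerAr -xw_cat -scalerAl xw_yw.
suff -> : xw K (stop (size w)) * d * yw K (stop (size w) ++ w) = 0.
  by rewrite addr0 scalerA mulVf // scale1r.
elim: ld => [|s u b uw _ IH]; first by rewrite mulr0 mul0r.
rewrite mulrDr mulrDl IH addr0 -scalerAr -scalerAl -xw_cat.
rewrite xw_yw_stop ?scaler0 //; last exact: wcode_size.
by apply: contraTneq uw => ->; rewrite ltnn.
Qed.

(* [u] embeds the row vectors of size N in L, with left inverse [w].           *)
Lemma row_col_free (a N : nat) (E : 'M[L]_(a, N)) :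
  exists (b : nat) (G : 'M[L]_(b, N)) (H : 'M_(a, b)) (H' : 'M_(b, a)),
  [/\ E = H *m G, G = H' *m E & forall z : 'rV_b, z *m G = 0 -> z = 0].
Proof.
pose u : 'cV[L]_N := \col_j xw K (stop j).
pose w : 'rV[L]_N := \row_j yw K (stop j).
have uw : u *m w = 1%:M.
  apply/matrixP=> i j; rewrite !mxE big_ord1 !mxE; have [->|ij] := eqVneq i j.
    by rewrite xw_yw.
  (* The suffix of [stop q] of the length of [stop p] consists of ones only, whereas [stop p] begins
     with 0. *)
  have neq (p q : nat) : (p < q)%N -> drop (size (stop q) - size (stop p)) (stop q) != stop p.
    move=> pq; rewrite /= !size_nseq subSS -(@prednK (q - p)) ?subn_gt0 //=.
    rewrite drop_nseq; have -> : (q - (q - p).-1 = p.+1)%N by lia.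
    by rewrite eqseq_cons oner_eq0.
  move: ij; rewrite -(inj_eq val_inj) neq_ltn /= => /orP[ij|ij].
    by apply: (proj1 (@xw_yw_drop _ _ _ (neq _ _ ij))); rewrite /= !size_nseq ltnS ltnW.
  by apply: (proj2 (@xw_yw_drop _ _ _ (neq _ _ ij))); rewrite /= !size_nseq ltnS ltnW.
pose e (t : 'I_a) := (E *m u) t 0.
have [S [g [v [gv eg ge _]]]] := reduced_family e.
have ig := reduced_indep gv.
have /choice[h hP] := eg; have /choice[h' h'P] := ge.
pose gam : 'cV[L]_#|S| := \col_s g (enum_val s).
pose H : 'M[L]_(a, #|S|) := \matrix_(i, s) h i (enum_val s).
pose H' : 'M[L]_(#|S|, a) := \matrix_(s, i) h' (enum_val s) i.
have EH : E *m u = H *m gam.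
  apply/matrixP=> i j; rewrite ord1 -[LHS]/(e i) hP mxE.
  have HE s : h i (enum_val s) * g (enum_val s) = H i s * gam s 0 by rewrite !mxE.
  by rewrite sum_enum_val; exact: (eq_bigr _ (fun s _ => HE s)).
have gH : gam = H' *m (E *m u).
  by apply/matrixP=> s j; rewrite ord1 mxE h'P mxE; apply: eq_bigr => i _; rewrite mxE.
exists #|S|, (gam *m w), H, H'; split.
- by rewrite mulmxA -EH -mulmxA uw mulmx1.
- by rewrite gH -!mulmxA uw mulmx1.
move=> z /(congr1 (mulmx^~ u)); rewrite mul0mx => zG.
have zg : z *m gam = 0.
  by rewrite gH -[u]mul1mx -uw -zG gH -!mulmxA.
apply/matrixP=> i s; rewrite ord1 mxE.
have := ig (fun t => z 0 (enum_rank t)) _ (enum_val s); rewrite enum_valK; apply.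
have := congr1 (fun A : 'M_1 => A 0 0) zg; rewrite [in X in _ = X -> _]mxE [LHS]mxE => zg0.
apply: etrans zg0.
have zE t : z 0 (enum_rank (enum_val t)) * g (enum_val t) = z 0 t * gam t 0.
  by rewrite enum_valK mxE.
by rewrite sum_enum_val; exact: (eq_bigr _ (fun t _ => zE t)).
Qed.

End Ideals.

(** * Isomorphisms with matrix algebras *)

Lemma perm_eq_bool (s t : seq bool) :
  size s = size t -> count id s = count id t -> perm_eq s t.
Proof.
move=> st ct; apply/permP => a.
have cE (r : seq bool) : (count a r + a false * count id r =
    a true * count id r + a false * size r)%N.
  by elim: r => [|[] r IHr] /=; rewrite ?muln0 //; case: (a true) (a false) IHr => [] [] /=; lia.
by have := cE s; have := cE t; rewrite st ct; lia.
Qed.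

Lemma perm_lift (T : eqType) (f : T -> bool) (s : seq T) (b : seq bool) :
  perm_eq b (map f s) -> exists2 r, perm_eq r s & map f r = b.
Proof.
case/(perm_iotaP false) => Is; rewrite size_map => pI ->.
case: s pI => [|x s] pI.
  by rewrite (perm_small_eq _ pI) //; exists [::].
exists (map (nth x (x :: s)) Is).
  by rewrite -[X in perm_eq _ X](mkseq_nth x); apply: perm_map.
rewrite -map_comp; apply/eq_in_map => i; rewrite (perm_mem pI) mem_iota => /andP[_ iP].
by rewrite [LHS]/= -(nth_map x false f iP).
Qed.

(** * Sturmian words *)

Section Sturm.
Variables (m d : nat).
Hypothesis md : (0 < m < d)%N.

(* A Sturmian word of slope m / d. With m e = -1 mod d, the shift by e         *)
(* preserves it except at the positions 0 and -1 mod d ([sturm_shift]), and   *)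
(* its numbers of [true] in intervals match those of the comb.                *)
Definition sturm (t : nat) : bool := (m * t %/ d < m * t.+1 %/ d)%N.

Let d0 : (0 < d)%N. Proof. by lia. Qed.

Lemma sturm_step t : (m * t.+1 %/ d = m * t %/ d + sturm t)%N.
Proof.
have : (m * t %/ d <= m * t.+1 %/ d)%N by apply: leq_div2r; rewrite leq_mul2l leqnSn orbT.
have : (m * t.+1 %/ d <= (m * t %/ d).+1)%N.
  have -> : ((m * t %/ d).+1 = (m * t + d) %/ d)%N by rewrite divnDr // divnn d0 addn1.
  by apply: leq_div2r; rewrite mulnS; lia.
by rewrite /sturm; case: ltngtP; lia.
Qed.

Lemma count_sturm a b : (count sturm (iota a b) + m * a %/ d = m * (a + b) %/ d)%N.
Proof.
elim: b a => [|b IHb] a; first by rewrite addn0.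
by rewrite /= -addSnnS -IHb sturm_step; lia.
Qed.

Lemma sturm_mod t : sturm (t %% d) = sturm t.
Proof.
rewrite [in RHS](divn_eq t d) /sturm -addnS !mulnDr mulnCA mulnA.
by rewrite -mulnA mulnCA !(mulnA _ _ d) !divnMDl // ltn_add2l.
Qed.

Lemma sturm0 : sturm 0 = false.
Proof. by rewrite /sturm muln0 div0n muln1 divn_small //; case/andP: md. Qed.

Lemma sturm_last : sturm d.-1.
Proof.
by rewrite /sturm prednK // mulnK // ltn_divLR // ltn_mul2l; lia.
Qed.

(** Here m (j + e) = m j - 1 + al d, and subtracting 1 changes the quotient by d only if d divides m
    j. As m is prime to d, this does not occur for 0 < j < d; it is applied to j = k and j = k +
    1. *)
Lemma sturm_shift e al k : (m * e + 1 = al * d)%N -> (0 < k)%N -> (k.+1 < d)%N ->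
  sturm (k + e) = sturm k.
Proof.
move=> E k0 kd.
have cop : coprime d m.
  apply/eqP; have /dvdnP[p pE] := dvdn_gcdl d m; have /dvdnP[q qE] := dvdn_gcdr d m.
  have : (gcdn d m %| 1)%N.
    rewrite -(@dvdn_addr (m * e)) ?E; first by rewrite dvdn_mull ?dvdn_gcdl.
    by rewrite dvdn_mulr ?dvdn_gcdr.
  by rewrite dvdn1 => /eqP.
have div_pred j : (0 < j < d)%N -> (m * (j + e) %/ d = al + m * j %/ d)%N.
  case/andP=> j0 jd; have : (m * j %% d != 0)%N.
    rewrite -/(dvdn d (m * j)) Gauss_dvdr //; apply/negP => /dvdn_leq; lia.
  move=> r0; have -> : (m * (j + e) = (al + m * j %/ d) * d + (m * j %% d).-1)%N.
    by have := divn_eq (m * j) d; rewrite mulnDr mulnDl; lia.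
  rewrite divnMDl // [(_.-1 %/ d)%N]divn_small ?addn0 //.
  by have := ltn_pmod (m * j) d0; move: (_ %% d)%N r0 => r; lia.
by rewrite /sturm -addSn !div_pred ?ltn_add2l //; lia.
Qed.

End Sturm.

Lemma sum_nat_single (V : pzSemiRingType) (p q : nat) (F : nat -> 'M[V]_(p, q)) d j :
  (j < d)%N -> (forall l, (l < d)%N -> l != j -> F l = 0) ->
  \sum_(0 <= l < d) F l = F j.
Proof.
move=> jd F0; rewrite big_mkord (bigD1 (Ordinal jd)) //= big1 ?addr0 // => l lj.
exact: F0.
Qed.

Lemma sum_nat_shift (V : nmodType) (F : nat -> V) a r :
  \sum_(a <= t < a + r) F t = \sum_(0 <= j < r) F (a + j)%N.
Proof.
rewrite -{1}[a]add0n big_addn addKn.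
by apply: eq_bigr => j _; rewrite addnC.
Qed.

(** * Matrix units between the nodes of a forest *)

Section MatrixUnits.
Variables (K : fieldType) (k D : nat).
Local Notation n := k.+2.
Local Notation d := D.+2.
Local Notation L := (leavitt K n).
Local Notation x i := (lv_x K (i : 'I_n)).
Local Notation y i := (lv_y K (i : 'I_n)).

(* [(j, w)] is the node with address [w], read upwards, in the j-th tree of a *)
(* forest of d n-ary trees; [move_mx mu nu] moves the subtree at nu onto the  *)
(* one at mu.                                                                 *)
Definition node : Type := 'I_d * seq 'I_n.
HB.instance Definition _ := Equality.on node.
Implicit Types (mu nu rho : node) (s : seq node).

Definition root (j : nat) : node := (inord j, [::]).
Definition child (p : 'I_n) nu : node := (nu.1, p :: nu.2).

(** The factor left in the middle of a product of two moves; it vanishes when neither node lies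
    above the other. *)
Definition pairing mu nu : L := (mu.1 == nu.1)%:R * (xw K mu.2 * yw K nu.2).

Definition move_mx mu nu : 'M[L]_d :=
  (yw K mu.2 * xw K nu.2) *: delta_mx mu.1 nu.1.

Lemma move_mx_mul mu nu nu' rho : move_mx mu nu *m move_mx nu' rho =
  (yw K mu.2 * pairing nu nu' * xw K rho.2) *: delta_mx mu.1 rho.1.
Proof.
apply/matrixP=> i j; rewrite !mxE (bigD1 nu.1) //= !mxE big1 => [|l lnu].
  rewrite addr0 eqxx /pairing; case: (i == mu.1); case: (j == rho.1);
    case: (nu.1 == nu'.1); rewrite ?mul1r ?mulr1 ?mul0r ?mulr0 ?mul0r //.
  by rewrite !mulrA.
by rewrite !mxE (negPf lnu) andbF mulr0 mul0r.
Qed.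

Lemma pairing_id nu : pairing nu nu = 1.
Proof. by rewrite /pairing eqxx mul1r xw_yw. Qed.

Lemma move_mx_trans mu nu rho : move_mx mu nu *m move_mx nu rho = move_mx mu rho.
Proof. by rewrite move_mx_mul pairing_id mulr1. Qed.

Lemma move_mx_mul0 mu nu nu' rho : pairing nu nu' = 0 ->
  move_mx mu nu *m move_mx nu' rho = 0.
Proof. by rewrite move_mx_mul => ->; rewrite mulr0 mul0r scale0r. Qed.

Lemma sum_move_child mu nu :
  \sum_p move_mx (child p mu) (child p nu) = move_mx mu nu.
Proof.
rewrite /move_mx /= -scaler_suml; congr (_ *: _).
under eq_bigr => p _ do rewrite yw_cons xw_cons mulrA -(mulrA (yw _ _)).
by rewrite -mulr_suml -mulr_sumr lv_yxE mulr1.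
Qed.

Lemma pairing_childl p mu nu : pairing (child p mu) nu = x p * pairing mu nu.
Proof.
by rewrite /pairing /= xw_cons -mulrA; case: eqP => _ /=; rewrite ?mul1r // !mul0r mulr0.
Qed.

Lemma pairing_childr p mu nu : pairing mu (child p nu) = pairing mu nu * y p.
Proof.
by rewrite /pairing /= yw_cons !mulrA.
Qed.

(** The roots of a partition of the forest into subtrees: their idempotents are orthogonal and sum
    up to 1. *)
Definition frame s : Prop :=
  [/\ uniq s, \sum_(nu <- s) move_mx nu nu = 1%:M &
      {in s &, forall mu nu, mu != nu -> pairing mu nu = 0}].

Lemma frame_perm s s' : perm_eq s s' -> frame s -> frame s'.
Proof.
move=> ss' [us sum1 orth]; split.
- by rewrite -(perm_uniq ss').
- by rewrite -(perm_big _ ss').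
by move=> mu nu; rewrite -!(perm_mem ss'); apply: orth.
Qed.

Lemma frame_expand nu s :
  frame (nu :: s) -> frame ([seq child p nu | p <- enum 'I_n] ++ s).
Proof.
case=> /= /andP[nus us] sum1 orth.
have cnu p : child p nu \notin s.
  apply/negP => cs; have := orth nu (child p nu); rewrite !inE eqxx cs orbT.
  case: eqP => [e|_ /(_ isT isT isT)]; first by rewrite e cs in nus.
  rewrite pairing_childr pairing_id mul1r => yp.
  by have /eqP := lv_xyE K p p; rewrite yp mulr0 eqxx eq_sym oner_eq0.
have o1 mu : mu \in s -> pairing nu mu = 0.
  by move=> ms; apply: orth; rewrite ?mem_head ?inE ?ms ?orbT //; apply/eqP => e; rewrite e ms in nus.
have o2 mu : mu \in s -> pairing mu nu = 0.
  by move=> ms; apply: orth; rewrite ?mem_head ?inE ?ms ?orbT //; apply/eqP => e; rewrite -e ms in nus.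
split.
- rewrite cat_uniq us andbT map_inj_uniq ?enum_uniq => [|p q [//]].
  by apply/hasPn => mu ms; apply/mapP => -[p _ e]; have := cnu p; rewrite -e ms.
- rewrite big_cat big_map big_enum /= sum_move_child -sum1.
  by rewrite big_cons.
move=> mu rho; rewrite !mem_cat => /orP[/mapP[p _ ->]|ms] /orP[/mapP[q _ ->]|rs] neq.
- rewrite pairing_childl pairing_childr pairing_id mul1r lv_xyE.
  by case: (p =P q) neq => [->|//]; rewrite eqxx.
- by rewrite pairing_childl o1 // mulr0.
- by rewrite pairing_childr o2 // mul0r.
by apply: orth neq; rewrite inE ?ms ?rs orbT.
Qed.

(** The leaves of the tree obtained by expanding [nu], then its child 0, and so on l times. *)
Fixpoint comb (l : nat) nu : seq node :=
  if l is l'.+1 then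
    [seq child p nu | p <- enum 'I_n & p != 0] ++ comb l' (child 0 nu)
  else [:: nu].

Lemma frame_comb l nu s : frame (nu :: s) -> frame (comb l nu ++ s).
Proof.
elim: l nu s => [//|l IHl] nu s /frame_expand fr /=.
rewrite -catA; apply: (@frame_perm (comb l (child 0 nu) ++
  ([seq child p nu | p <- enum 'I_n & p != 0] ++ s))).
  by rewrite perm_catCA.
apply: IHl; apply: frame_perm fr; rewrite -cat_cons perm_cat2r.
rewrite -[child 0 nu :: _]/(map (child^~ nu) (0 :: _)); apply: perm_map.
rewrite -(perm_filterC (pred1 0) (enum 'I_n)) -[0 :: _]cat1s perm_sym.
rewrite perm_cat2r; apply: uniq_perm => [//||p].
  by apply: filter_uniq; apply: enum_uniq.
by rewrite mem_filter mem_enum andbT inE.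
Qed.

Lemma frame_roots : frame (map root (iota 0 d)).
Proof.
have inj : {in iota 0 d &, injective root}.
  move=> i j; rewrite !mem_iota /= !add0n => id jd [/(congr1 val)].
  by rewrite /= !inordK.
split; first by rewrite map_inj_in_uniq ?iota_uniq.
  rewrite big_map -[iota 0 d]/(index_iota 0 d) big_mkord mx1_sum_delta.
  apply: eq_bigr => i _.
  by rewrite /move_mx /= xw0 yw0 mulr1 scale1r inord_val.
move=> _ _ /mapP[i _ ->] /mapP[j _ ->] ij.
rewrite /pairing /=; case: eqP => [e|_]; last by rewrite mul0r.
by rewrite /root e eqxx in ij.
Qed.

Lemma sum_move_root : \sum_(0 <= j < d) move_mx (root j) (root j) = 1%:M.
Proof. by case: frame_roots => _ <- _; rewrite big_map. Qed.

Section Onto.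
(** The numbering constructed in [leaf_exists]. Root 0 is expanded once, the roots 1, ..., D stay
    whole and a comb of depth D + 1 hangs from the last root. Of the numbers of the comb leaves,
    only the Sturmian letters matter. *)
Variables (m al : nat) (leaf : nat -> node).
Hypothesis md : (0 < m < d)%N.
Hypothesis mal : (m * k.+1 + 1 = al * d)%N.
Local Notation sturm := (sturm m d).
Hypothesis leaf_pairing : forall t t', (t < n * d)%N -> (t' < n * d)%N ->
  pairing (leaf t) (leaf t') = (t == t')%:R.
Hypothesis leaf_sum : \sum_(0 <= t < n * d) move_mx (leaf t) (leaf t) = 1%:M.
Hypothesis leaf_first : forall p : 'I_n, leaf p = child p (root 0).
Hypothesis leaf_middle : forall j, (j < D)%N -> leaf (n + j) = root j.+1.
Hypothesis leaf_comb : forall l (p : 'I_n), (l <= D)%N -> p != 0 ->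
  exists t, [/\ (t < n * d)%N, leaf t = (inord D.+1, p :: nseq l 0) &
                sturm t = sturm p].
Hypothesis leaf_comb_end : exists t, [/\ (t < n * d)%N,
  leaf t = (inord D.+1, nseq D.+1 0) & sturm t = false].

(** The i-th block of d leaves is moved onto the d roots; [mat_y i] moves them back. *)
Definition mat_x (i : 'I_n) : 'M[L]_d :=
  \sum_(0 <= j < d) move_mx (root j) (leaf (i * d + j)).
Definition mat_y (i : 'I_n) : 'M[L]_d :=
  \sum_(0 <= j < d) move_mx (leaf (i * d + j)) (root j).

Let leaf_lt (i : 'I_n) j : (j < d)%N -> (i * d + j < n * d)%N.
Proof.
move=> jd; apply: (@leq_trans (i.+1 * d)); first by rewrite mulSn addnC ltn_add2r.
by rewrite leq_mul2r ltn_ord orbT.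
Qed.

Lemma root_pairing i j : (i < d)%N -> (j < d)%N ->
  pairing (root i) (root j) = (i == j)%:R.
Proof.
move=> id jd; have [->|ij] := eqVneq i j; first exact: pairing_id.
rewrite /pairing /= -(inj_eq val_inj) /= !inordK // (negPf ij) mul0r //.
Qed.

Lemma mat_y_root i j rho : (j < d)%N ->
  mat_y i *m move_mx (root j) rho = move_mx (leaf (i * d + j)) rho.
Proof.
move=> jd; rewrite mulmx_suml (sum_nat_single jd) ?move_mx_trans // => l ld lj.
by apply: move_mx_mul0; rewrite root_pairing // (negPf lj).
Qed.

Lemma root_mat_x i j rho : (j < d)%N ->
  move_mx rho (root j) *m mat_x i = move_mx rho (leaf (i * d + j)).
Proof.
move=> jd; rewrite mulmx_sumr (sum_nat_single jd) ?move_mx_trans // => l ld lj.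
by apply: move_mx_mul0; rewrite root_pairing // eq_sym (negPf lj).
Qed.

Lemma mat_x_leaf (i i' : 'I_n) j rho : (j < d)%N ->
  mat_x i *m move_mx (leaf (i' * d + j)) rho =
  if i == i' then move_mx (root j) rho else 0.
Proof.
move=> jd; have neq l : (l < d)%N -> (i != i') || (l != j) ->
    pairing (leaf (i * d + l)) (leaf (i' * d + j)) = 0.
  move=> ld; rewrite leaf_pairing ?leaf_lt //; have [e|//] := eqVneq (i * d + l)%N (i' * d + j)%N.
  have eii : i = i'.
    by apply: val_inj; have := congr1 (divn^~ d) e; rewrite /= !divnMDl // !divn_small // !addn0.
  by move: e; rewrite eii eqxx => /addnI ->; rewrite eqxx.
rewrite mulmx_suml; have [ii|ii] := eqVneq i i'.
  rewrite (sum_nat_single jd) => [|l ld lj]; first by rewrite ii move_mx_trans.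
  by apply/move_mx_mul0/neq; rewrite ?lj ?orbT.
rewrite big_nat big1 // => l /andP[_ ld].
by apply/move_mx_mul0/neq; rewrite ?ii.
Qed.

Lemma mat_xy i j : mat_x i *m mat_y j = if i == j then 1%:M else 0.
Proof.
rewrite /mat_y mulmx_sumr; rewrite (eq_big_nat _ _ (F2 := fun l =>
  if i == j then move_mx (root l) (root l) else 0)) => [|l /andP[_ ld]]; last first.
  exact: mat_x_leaf.
case: eqP => _; last by rewrite big1.
exact: sum_move_root.
Qed.

Lemma mat_yx_part i r : (r <= d)%N ->
  mat_y i *m (\sum_(0 <= j < r) move_mx (root j) (root j)) *m mat_x i =
  \sum_(0 <= j < r) move_mx (leaf (i * d + j)) (leaf (i * d + j)).
Proof.
move=> rd; rewrite [mat_y i *m _]mulmx_sumr mulmx_suml.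
have term j : (0 <= j < r)%N ->
    mat_y i *m move_mx (root j) (root j) *m mat_x i =
    move_mx (leaf (i * d + j)) (leaf (i * d + j)).
  by case/andP=> _ jr; rewrite mat_y_root ?root_mat_x // (leq_trans jr rd).
exact: (eq_big_nat _ _ term).
Qed.

Lemma mat_yx i : mat_y i *m mat_x i =
  \sum_(i * d <= t < i.+1 * d) move_mx (leaf t) (leaf t).
Proof.
rewrite mulSn [(d + _)%N]addnC sum_nat_shift.
rewrite -[mat_y i]mulmx1 -sum_move_root.
by rewrite mat_yx_part.
Qed.

Lemma mat_yx_sum : \sum_i mat_y i *m mat_x i = 1%:M.
Proof.
rewrite -leaf_sum big_nat_mul big_mkord; apply: eq_bigr => i _.
exact: mat_yx.
Qed.

(* The prefix sums of the diagonal matrix units are reached by following      *)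
(* k -> k + (n - 1) mod d down to 0. The subtrees then identify all roots of  *)
(* equal Sturmian letter, and the comb hanging from the last root identifies  *)
(* this root with the first one.                                              *)
Lemma mat_generate (f : {lrmorphism L -> matalg L d}) :
  (forall i, f (x i) = mat_x i) -> (forall i, f (y i) = mat_y i) ->
  forall M, exists a, f a = M.
Proof.
move=> fx fy; pose inA (M : 'M[L]_d) := exists a, f a = M.
have inA0 : inA 0 by exists 0; rewrite rmorph0.
have inAD M N : inA M -> inA N -> inA (M + N).
  by case=> a <- [b <-]; exists (a + b); rewrite rmorphD.
have inA_sum (I : Type) (r : seq I) (P : pred I) (G : I -> 'M[L]_d) :
    (forall i, P i -> inA (G i)) -> inA (\sum_(i <- r | P i) G i).
  by apply: (big_ind inA); [exact: inA0|exact: inAD].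
have inAB M N : inA M -> inA N -> inA (M - N).
  by case=> a <- [b <-]; exists (a - b); rewrite rmorphB.
have inAM M N : inA M -> inA N -> inA (M *m N).
  by case=> a <- [b <-]; exists (a * b); rewrite rmorphM.
have inAx i : inA (mat_x i) by exists (x i).
have inAy i : inA (mat_y i) by exists (y i).
pose E r := \sum_(0 <= j < r) move_mx (root j) (root j).
pose F r := \sum_(0 <= t < r) move_mx (leaf t) (leaf t).
have Ed : E d = 1%:M := sum_move_root.
(* The first r leaves consist of full blocks, with sums [mat_y i *m mat_x i], and an initial segment
   of the next block, obtained from [E (r %% d)]. *)
have FE r : (r < n * d)%N -> inA (E (r %% d)%N) -> inA (F r).
  move=> rn; have : (r %/ d < n)%N by rewrite ltn_divLR.
  have : (r %% d < d)%N by rewrite ltn_pmod.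
  move: (divn_eq r d); move: (r %/ d)%N (r %% d)%N => q e rE ed qn Ee.
  have -> : F r = \sum_(0 <= i < q) \sum_(i * d <= t < i.+1 * d)
       move_mx (leaf t) (leaf t) +
     mat_y (Ordinal qn) *m E e *m mat_x (Ordinal qn).
    rewrite -big_nat_mul mat_yx_part ?(ltnW ed) //= /F rE.
    rewrite (@big_cat_nat _ _ _ (q * d)%N) ?leq_addr //=; congr (_ + _).
    exact: sum_nat_shift.
  apply: inAD; last by apply/inAM/inAx/inAM.
  rewrite big_nat; apply: inA_sum => i /andP[_ ir].
  by rewrite -(mat_yx (Ordinal (ltn_trans ir qn))); apply: inAM.
(* The n children of root 0 replace one root, so passing from roots to leaves shifts the index by n
   - 1. *)
have EF r : (r <= D)%N -> E r.+1 = F (n + r)%N.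
  move=> rD; have Fn : F n = move_mx (root 0) (root 0).
    rewrite /F big_mkord -sum_move_child.
    by apply: eq_bigr => p _; rewrite leaf_first.
  rewrite /F (@big_cat_nat _ _ _ n) ?leq_addr // -/(F n) Fn /E [LHS]big_ltn //=.
  congr (_ + _); rewrite (sum_nat_shift _ 1 r) (sum_nat_shift _ n r).
  by apply: eq_big_nat => j /andP[_ jr]; rewrite leaf_middle // (leq_trans jr rD).
have inE r : (r < d)%N -> inA (E r).
  suff inEj j q : (q < d)%N -> ((q + j * k.+1) %% d = 0)%N -> inA (E q).
    (* After r m steps of length n - 1 the index is r (1 + m (n - 1)) = r al d, which is 0 mod d. *)
    move=> rd; apply: (inEj (r * m)%N) => //.
    have -> : (r + r * m * k.+1 = r * al * d)%N by rewrite -!mulnA -mal; lia.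
    exact: modnMl.
  have E0 : inA (E 0) by rewrite /E big_geq.
  elim: j q => [|j IHj] [|q] qd qj; try exact: E0.
    by move: qj; rewrite mul0n addn0 modn_small.
  rewrite EF //; apply: FE; first by nia.
  by apply: IHj; rewrite ?ltn_pmod // modnDml -[RHS]qj; congr (_ %% _)%N; lia.
have inr j : (j < d)%N -> inA (move_mx (root j) (root j)).
  move=> jd; have -> : move_mx (root j) (root j) = E j.+1 - E j.
    by rewrite /E big_nat_recr //= addrC addrK.
  apply: inAB; last exact: inE.
  move: jd; rewrite leq_eqVlt => /orP[/eqP ->|/inE //].
  by rewrite Ed; exists 1; rewrite rmorph1.
pose eqv mu nu := inA (move_mx mu nu) /\ inA (move_mx nu mu).
have eqvS mu nu : eqv mu nu -> eqv nu mu by case.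
have eqvT mu nu rho : eqv mu nu -> eqv nu rho -> eqv mu rho.
  by case=> h1 h2 [h3 h4]; split; rewrite -(move_mx_trans _ nu); apply: inAM.
have eqv_leaf t : (t < n * d)%N -> eqv (leaf t) (root (t %% d)%N).
  move=> tn; have qn : (t %/ d < n)%N by rewrite ltn_divLR.
  have td : (t %% d < d)%N by rewrite ltn_pmod.
  split; [have := mat_y_root (Ordinal qn) (root (t %% d)) td|
          have := root_mat_x (Ordinal qn) (root (t %% d)) td];
    by rewrite /= -divn_eq => <-; apply: inAM => //; apply: inr.
have eqv_child mu nu : (forall p, eqv (child p mu) (child p nu)) -> eqv mu nu.
  by move=> h; split; rewrite -sum_move_child; apply: inA_sum => p _; case: (h p).
have shift q : (0 < q)%N -> (q <= D)%N ->
    eqv (root q) (root ((q + k.+1) %% d)%N) /\ sturm ((q + k.+1) %% d)%N = sturm q.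
  move=> q0 qD; rewrite sturm_mod //; split; last exact: sturm_shift mal _ _.
  have := @eqv_leaf (n + q.-1)%N; rewrite leaf_middle ?prednK //.
  have -> : (n + q.-1 = q + k.+1)%N by lia.
  by apply; nia.
pose rep (b : bool) := root (if b then D.+1 else 0%N).
(* The steps by n - 1 mod d keep the letter until they hit 0, with letter false, or d - 1, with
   letter true. From q, (q + 1) m steps lead to -1 mod d and q m steps to 0, so an end is reached,
   and the letter of q tells which. *)
have eqv_root q : (q < d)%N -> eqv (root q) (rep (sturm q)).
  suff eqv_j j q' : (q' < d)%N ->
      ((q' + j * k.+1) %% d = if sturm q' then D.+1 else 0)%N ->
      eqv (root q') (rep (sturm q')).
    move=> qd; case sq : (sturm q).
      rewrite -sq; apply: (eqv_j (q.+1 * m)%N); rewrite // sq.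
      have -> : (q + q.+1 * m * k.+1 = (q.+1 * al).-1 * d + D.+1)%N.
        by have : (0 < al)%N; [case: (al) mal; lia|]; rewrite -mulnA; nia.
      by rewrite modnMDl modn_small.
    rewrite -sq; apply: (eqv_j (q * m)%N); rewrite // sq.
    have -> : (q + q * m * k.+1 = q * al * d)%N by rewrite -!mulnA -mal; lia.
    exact: modnMl.
  elim: j q' => [|j IHj] q' qd.
    by rewrite mul0n addn0 modn_small // /rep => <-; split; apply: inr.
  have [->|q0] := posnP q'.
    by rewrite sturm0 // => _; split; apply: inr.
  move: (qd); rewrite ltnS leq_eqVlt => /orP[/eqP ->|qD].
    have := sturm_last md; rewrite /= => -> _; split; exact: inr.
  have [e se] := shift q' q0 qD => qj.
  apply: eqvT e _; rewrite -se; apply: IHj; rewrite ?ltn_pmod // se -qj modnDml.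
  by congr (_ %% _)%N; lia.
have eqv_leaf_rep t : (t < n * d)%N -> eqv (leaf t) (rep (sturm t)).
  move=> tn; apply: eqvT (eqv_leaf t tn) _; rewrite -(sturm_mod md).
  by apply: eqv_root; rewrite ltn_pmod.
have eqv_first (p : 'I_n) : eqv (child p (root 0)) (rep (sturm p)).
  rewrite -leaf_first; apply: eqv_leaf_rep; have := ltn_ord p; nia.
(* Induction from the end of the comb up to its root: each child of a spine node is equivalent to
   the child of root 0 with the same letter, hence so are the two parents. *)
have eqv_spine l : (l <= D.+1)%N -> eqv (inord D.+1, nseq (D.+1 - l) 0) (root 0).
  elim: l => [_|l IHl lD].
    have [t [tn tE st]] := leaf_comb_end.
    by rewrite subn0 -tE; have := eqv_leaf_rep t tn; rewrite st.
  apply: eqv_child => p; apply: eqvT (eqvS _ _ (eqv_first p)).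
  have [->|p0] := eqVneq p 0.
    by rewrite sturm0 //; have := IHl (ltnW lD); rewrite -(subnSK lD).
  have [t [tn tE st]] := @leaf_comb (D.+1 - l.+1)%N p (leq_subr _ _) p0.
  by rewrite /child /= -tE -st; apply: eqv_leaf_rep.
have eqv_rep b : eqv (rep b) (root 0).
  case: b; last by split; apply: inr.
  by have := eqv_spine D.+1 (leqnn _); rewrite subnn.
(* All children of root 0 are now equivalent to root 0, which puts the multiples of the corner unit
   by each x_p and y_p in the image. *)
have inAa (a : L) : inA (a *: delta_mx 0 0).
  have r0 : root 0 = (0 : 'I_d, [::]).
    by congr (_, _); apply: val_inj; rewrite /= inordK.
  elim/leavitt_ind: a => [p|p|r|a b Ha Hb|a b Ha Hb].
  - have [_] := eqvT _ _ _ (eqv_first p) (eqv_rep _).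
    by rewrite r0 /move_mx /= yw0 mul1r xw_cons xw0 mulr1.
  - have [+ _] := eqvT _ _ _ (eqv_first p) (eqv_rep _).
    by rewrite r0 /move_mx /= xw0 mulr1 yw_cons yw0 mul1r.
  - have [a aE] := inr 0%N isT; exists (r *: a).
    transitivity (r *: (f a : matalg L d)); [exact: linearZ|rewrite aE].
    rewrite r0 /move_mx /= xw0 yw0 mulr1 scale1r.
    by apply/matrixP=> i j; rewrite !mxE mulr_algl.
  - by rewrite scalerDl; apply: inAD.
  have -> : (a * b) *: (delta_mx 0 0 : 'M[L]_d) =
      (a *: (delta_mx 0 0 : 'M_d)) *m (b *: (delta_mx 0 0 : 'M_d)).
    apply/matrixP=> i j; rewrite !mxE (bigD1 0) //= big1 => [|l l0]; rewrite !mxE.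
      rewrite eqxx andbT addr0.
      by case: (i == 0); case: (j == 0); rewrite /= ?mulr1 ?mulr0 ?mul0r.
    by rewrite (negPf l0) andbF mulr0 mul0r.
  exact: inAM.
move=> M; rewrite -/(inA M) [M]matrix_sum_delta.
apply: (@inA_sum) => i _; apply: (@inA_sum) => j _.
have to0 (l : 'I_d) : eqv (root l) (root 0).
  exact: eqvT (eqv_root l (ltn_ord l)) (eqv_rep _).
have [[Hi _] [_ Hj]] := (to0 i, to0 j).
have := inAM _ _ (inAM _ _ Hi (inAa (M i j))) Hj.
suff -> : move_mx (root i) (root 0) *m (M i j *: delta_mx 0 0) *m
    move_mx (root 0) (root j) = M i j *: delta_mx i j by [].
have r0 : inord 0 = 0 :> 'I_d by apply: val_inj; rewrite /= inordK.
rewrite /move_mx /= yw0 xw0 mulr1 !scale1r !inord_val !r0.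
apply/matrixP=> a b; rewrite !mxE (bigD1 0) //= big1 => [|l l0]; last first.
  by rewrite !mxE (negPf l0) mulr0.
rewrite !mxE (bigD1 0) //= big1 => [|l l0]; last first.
  by rewrite !mxE (negPf l0) andbF mul0r.
rewrite !mxE !eqxx /= andbT !addr0 mulr1.
by case: (a == i); case: (b == j); rewrite ?mul0r ?mulr0 ?mul1r ?mulr1.
Qed.

End Onto.
End MatrixUnits.

Lemma bijective_inj_surj (S T : Type) (f : S -> T) :
  injective f -> (forall b, exists a, f a = b) -> bijective f.
Proof.
by move=> fi /choice[g gP]; exists g => // a; apply: fi; rewrite gP.
Qed.

Lemma nseq_cat_cons (T : Type) j (a : T) s : nseq j a ++ a :: s = a :: nseq j a ++ s.
Proof. by elim: j => //= j ->. Qed.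

(** * Numbering the leaves along a Sturmian word *)

Section LeafArrangement.
Variables (K : fieldType) (k D m al : nat).
Local Notation n := k.+2.
Local Notation d := D.+2.
Local Notation L := (leavitt K n).
Hypothesis md : (0 < m < d)%N.
Hypothesis mal : (m * k.+1 + 1 = al * d)%N.
Local Notation sturm := (sturm m d).
Local Notation node := (node k D).
Local Notation root := (@root k D).
Implicit Types (nu : node).

(** The Sturmian letter that the number of a comb leaf should have, so that it matches the
    corresponding child of root 0. *)
Definition label nu : bool := if nu.2 is p :: _ then sturm (p : 'I_n) else false.

Lemma size_comb l nu : size (comb l nu) = (l * k.+1 + 1)%N.
Proof.
elim: l nu => [//|l IHl] nu /=; rewrite size_cat IHl size_map.
suff -> : size [seq p <- enum 'I_n | p != 0] = k.+1 by rewrite mulSn addnA.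
rewrite size_filter; apply/eqP; rewrite -(eqn_add2l (count (pred1 0) (enum 'I_n))).
by rewrite count_predC size_enum_ord count_uniq_mem ?enum_uniq // mem_enum.
Qed.

Lemma count_sturm_first : count sturm (iota 0 n) = al.
Proof.
have := count_sturm md 0 n; rewrite muln0 div0n addn0 add0n => ->.
have -> : (m * n = al * d + m.-1)%N by rewrite -mal; case: (m) md => //=; lia.
by rewrite divnMDl // divn_small ?addn0 //; lia.
Qed.

(** Each level contributes the children p != 0. As [sturm 0] is false, they carry all the al letters
    true among the first n, and the end of the comb adds none. *)
Lemma count_label_comb l nu : label nu = false ->
  count label (comb l nu) = (l * al)%N.
Proof.
elim: l nu => [|l IHl] nu lnu /=; first by rewrite lnu.
rewrite count_cat IHl; last by rewrite /label /= sturm0.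
rewrite mulSn; congr (_ + _)%N; rewrite count_map count_filter.
rewrite -count_sturm_first -val_enum_ord count_map.
apply: eq_count => p /=; have [->|] := eqVneq p 0; last by rewrite andbT.
by rewrite andbF sturm0.
Qed.

Lemma mem_comb_end l i (w : seq 'I_n) : (i, nseq l 0 ++ w) \in comb l ((i, w) : node).
Proof.
elim: l w => [|l IHl] w; first exact: mem_head.
rewrite /= mem_cat; apply/orP; right.
by have := IHl (0 :: w); rewrite nseq_cat_cons.
Qed.

Lemma mem_comb l j i p (w : seq 'I_n) : (j < l)%N -> p != 0 ->
  (i, p :: nseq j 0 ++ w) \in comb l ((i, w) : node).
Proof.
elim: l j w => [//|l IHl] [|j] w jl p0 /=; rewrite mem_cat; apply/orP.
  left; rewrite -[(i, _)]/(child p ((i, w) : node)).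
  by apply: map_f; rewrite mem_filter p0 mem_enum.
by right; have := IHl j (0 :: w) jl p0; rewrite nseq_cat_cons.
Qed.

(** It suffices that the numbers of letters true agree. On the interval of the remaining leaf
    numbers it is m n - (al + m - 1), which is (D + 1) al because m (n - 1) + 1 = al d. *)
Lemma arrange_comb : exists2 cb : seq node, perm_eq cb (comb D.+1 (root D.+1)) &
  map label cb = map sturm (iota (n + D) (D.+1 * k.+1 + 1)).
Proof.
apply: perm_lift; apply: perm_eq_bool; rewrite ?size_map ?size_iota ?size_comb //.
rewrite !count_map (@eq_count _ _ sturm) // (@eq_count _ _ label) //.
rewrite count_label_comb //; have := count_sturm md (n + D) (D.+1 * k.+1 + 1).
have -> : (m * (n + D + (D.+1 * k.+1 + 1)) = m * n * d)%N by lia.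
rewrite mulnK //.
have -> : (m * (n + D) = (al + m.-1) * d + (d.-1 - m))%N.
  by have := mal; case: (m) md => //= m'; nia.
rewrite divnMDl // divn_small ?addn0; last by lia.
by have := mal; case: (m) md => //= m'; nia.
Qed.

Lemma leaf_exists : exists leaf : nat -> node,
  [/\ forall t t', (t < n * d)%N -> (t' < n * d)%N ->
        pairing K (leaf t) (leaf t') = (t == t')%:R,
      \sum_(0 <= t < n * d) move_mx K (leaf t) (leaf t) = 1%:M,
      forall p : 'I_n, leaf p = child p (root 0),
      forall j, (j < D)%N -> leaf (n + j)%N = root j.+1 &
      (forall l (p : 'I_n), (l <= D)%N -> p != 0 ->
        exists t, [/\ (t < n * d)%N, leaf t = (inord D.+1, p :: nseq l 0) &
                      sturm t = sturm p]) /\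
      exists t, [/\ (t < n * d)%N, leaf t = (inord D.+1, nseq D.+1 0) &
                    sturm t = false]].
Proof.
have [cb pcb lcb] := arrange_comb.
pose first := [seq child p (root 0) | p <- enum 'I_n].
pose mid := map root (iota 1 D); pose s := first ++ mid ++ cb.
have sf : size first = n by rewrite size_map size_enum_ord.
have sm : size mid = D by rewrite size_map size_iota.
have sc : size cb = (D.+1 * k.+1 + 1)%N by rewrite (perm_size pcb) size_comb.
have ss : size s = (n * d)%N by rewrite !size_cat sf sm sc; lia.
have [us sum1 orth] : frame K s.
  apply: (@frame_perm _ _ _ (comb D.+1 (root D.+1) ++ first ++ mid)).
    by rewrite perm_catC -catA !perm_cat2l perm_sym.
  apply: frame_comb; apply: (@frame_perm _ _ _ (first ++ mid ++ [:: root D.+1])).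
    by rewrite catA perm_catC.
  apply: frame_expand; have := frame_roots K k D.
  by rewrite -[D.+2]addn1 iotaD map_cat.
pose leaf t := nth (root 0) s t.
have leaf_cb nu : nu \in cb ->
    exists t, [/\ (t < n * d)%N, leaf t = nu & sturm t = label nu].
  move=> nucb; pose i := index nu cb; have ic : (i < size cb)%N by rewrite index_mem.
  exists (n + D + i)%N; split.
  - by rewrite -ss !size_cat sf sm addnA ltn_add2l.
  - rewrite /leaf /s catA nth_cat size_cat sf sm ltnNge leq_addr /= addKn.
    exact: nth_index.
  have := congr1 (nth false ^~ i) lcb; rewrite (nth_map nu) // nth_index // => ->.
  by rewrite (nth_map 0%N) ?size_iota -?sc // nth_iota -?sc.
exists leaf; split.
- move=> t t'; rewrite -ss => tn tn'; have [->|tt] := eqVneq t t'.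
    exact: pairing_id.
  by apply: orth; rewrite ?mem_nth // nth_uniq.
- by rewrite -sum1 (big_nth (root 0)) ss.
- move=> p; rewrite /leaf nth_cat sf ltn_ord (nth_map 0) ?size_enum_ord //.
  by rewrite nth_ord_enum.
- move=> j jD; rewrite /leaf nth_cat sf ltnNge leq_addr /= addKn nth_cat sm jD.
  by rewrite (nth_map 0%N) ?size_iota // nth_iota.
split=> [l p lD p0|].
  have [|t [tn tE st]] := leaf_cb (inord D.+1, p :: nseq l 0); last by exists t.
  by rewrite (perm_mem pcb); have := @mem_comb D.+1 l (inord D.+1) p [::] lD p0; rewrite cats0.
have [|t [tn tE st]] := leaf_cb (inord D.+1, nseq D.+1 0); last first.
  by exists t; split=> //; rewrite st /label /= sturm0.
by rewrite (perm_mem pcb); have := mem_comb_end D.+1 (inord D.+1) [::]; rewrite cats0.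
Qed.

End LeafArrangement.

Lemma leavitt_matrix_iso (K : fieldType) (k d : nat) : coprime d.+1 k.+1 ->
  exists f : {lrmorphism leavitt K k.+2 -> matalg (leavitt K k.+2) d.+1},
    bijective f.
Proof.
case: d => [_|D cop].
  have [||f fE] := @exists_lrmorphism K (leavitt K k.+2)
      (matalg (leavitt K k.+2) 1) (fun a => (a%:M : 'M_1)).
  - by move=> r a b; apply/matrixP=> i j; rewrite !mxE ord1 (ord1 j) !eqxx.
  - by split=> // a b; apply/matrixP=> i j; rewrite !mxE big_ord1 !mxE ord1 (ord1 j) !eqxx.
  exists f; exists (fun M : matalg (leavitt K k.+2) 1 => (M : 'M_1) 0 0) => [a|M].
    by rewrite fE mxE.
  by rewrite fE; apply/matrixP=> i j; rewrite mxE !ord1 eqxx.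
(* The slope m is the inverse of -(n - 1) modulo d; it is not 0 because d > 1. *)
have [m mD] := Bezoutl k.+1 (ltn0Sn D.+1); rewrite (eqP cop) => /dvdnP[al mal].
have m0 : (0 < m)%N by case: m mal {mD} => // /eqP; rewrite mul0n addn0 eq_sym muln_eq1 => /andP[_].
have md : (0 < m < D.+2)%N by rewrite m0.
have mal' : (m * k.+1 + 1 = al * D.+2)%N by rewrite addnC.
have [leaf [lp ls lf lm [lc le]]] := leaf_exists K md mal'.
have [||f [fx fy]] := @leavitt_lift K k (matalg (leavitt K k.+2) D.+2)
    (mat_x K leaf) (mat_y K leaf).
- by move=> i j; rewrite [LHS](mat_xy lp); case: eqP.
- exact: (mat_yx_sum ls).
exists f; apply: bijective_inj_surj.
  (* The kernel of f is a proper ideal, hence zero by simplicity. *)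
  move=> a b fab; apply/eqP; rewrite -subr_eq0; apply/negPn/negP => ab.
  have [u [v uv]] := leavitt_simple ab.
  have f0 : f (a - b) = 0 by apply: etrans (rmorphB f a b) _; rewrite /= fab subrr.
  have f1 : f (u * (a - b) * v) = 1 by rewrite uv; exact: rmorph1.
  have := oner_neq0 (matalg (leavitt K k.+2) D.+2); rewrite -f1.
  have -> : f (u * (a - b) * v) = f u * f (a - b) * f v.
    by apply: etrans (rmorphM f _ _) _; congr (_ * _); apply: rmorphM.
  by rewrite f0 mulr0 mul0r eqxx.
exact: (mat_generate md mal' lf lm lc le fx fy).
Qed.

(** * Isomorphisms between free modules of finite rank *)

Section RectangularInverse.
Variable R : pzRingType.

Lemma rectinv_refl a : rectinv R a a.
Proof. by exists 1%:M, 1%:M; rewrite mulmx1. Qed.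

Lemma rectinv_sym a b : rectinv R a b -> rectinv R b a.
Proof. by case=> P [Q [PQ QP]]; exists Q, P. Qed.

Lemma rectinv_trans a b c : rectinv R a b -> rectinv R b c -> rectinv R a c.
Proof.
case=> P [Q [PQ QP]] [P' [Q' [PQ' QP']]]; exists (P *m P'), (Q' *m Q).
split; first by rewrite mulmxA -(mulmxA P) PQ' mulmx1.
by rewrite mulmxA -(mulmxA Q') QP mulmx1.
Qed.

Lemma rectinv_add a b a' b' :
  rectinv R a b -> rectinv R a' b' -> rectinv R (a + a') (b + b').
Proof.
case=> P [Q [PQ QP]] [P' [Q' [PQ' QP']]].
exists (block_mx P 0 0 P'), (block_mx Q 0 0 Q').
by rewrite !mulmx_block !mul0mx !mulmx0 !addr0 !add0r PQ QP PQ' QP' -!scalar_mx_block.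
Qed.

End RectangularInverse.

Section LeavittRect.
Variables (K : fieldType) (k : nat).
Local Notation L := (leavitt K k.+2).

Lemma rectinv_leavitt : rectinv L 1 k.+2.
Proof.
exists (\row_j lv_y K j), (\col_i lv_x K i); split; apply/matrixP=> i j; rewrite !mxE.
  rewrite !ord1 eqxx /= -(lv_yxE K); apply: eq_bigr => z _; by rewrite !mxE.
by rewrite big_ord1 !mxE lv_xyE; case: (i == j).
Qed.

Lemma rectinv_leavitt_addr a t : rectinv L a.+1 (a + t * k.+1).+1.
Proof.
elim: t => [|t IHt]; first by rewrite mul0n addn0; apply: rectinv_refl.
apply: rectinv_trans IHt _.
have -> : ((a + t.+1 * k.+1).+1 = (a + t * k.+1) + k.+2)%N by lia.
by have := rectinv_add (rectinv_refl L (a + t * k.+1)) rectinv_leavitt; rewrite addn1.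
Qed.

Lemma rectinv_leavitt_mod a b : (0 < a)%N -> (0 < b)%N ->
  a = b %[mod k.+1]%N -> rectinv L a b.
Proof.
have lep p q : (0 < p)%N -> (p <= q)%N -> p = q %[mod k.+1]%N -> rectinv L p q.
  move=> p0 pq /esym/eqP; rewrite eqn_mod_dvd // => /dvdnP[t tE].
  have -> : q = (p.-1 + t * k.+1).+1 by lia.
  by rewrite -{1}(prednK p0); apply: rectinv_leavitt_addr.
move=> a0 b0 ab; have [le|/ltnW le] := leqP a b; first exact: lep.
by apply/rectinv_sym/lep.
Qed.

(** Adding b k + 1 to both ranks turns b into b (k + 1) + 1, whose free module is L^1, and
    [rectinv1_mod] applies. *)
Lemma rectinv_leavitt_eqmod a b : rectinv L a b -> a = b %[mod k.+1]%N.
Proof.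
move=> ab; have ab' : rectinv L (a + (b * k).+1) (b * k.+1).+1.
  have -> : ((b * k.+1).+1 = b + (b * k).+1)%N by lia.
  exact: rectinv_add ab (rectinv_refl _ _).
have ab1 : rectinv L (a + (b * k).+1) 1.
  exact: rectinv_trans ab' (rectinv_sym (rectinv_leavitt_addr 0 b)).
apply/eqP; rewrite -(eqn_modDr (b * k).+1) (rectinv1_mod ab1).
have -> : (b + (b * k).+1 = b * k.+1 + 1)%N by lia.
by rewrite modnMDl.
Qed.

End LeavittRect.

Section EntrywiseScale.
Variables (K : fieldType) (A : algType K) (r : K) (p q s : nat).
Variables (M : 'M[A]_(p, q)) (N : 'M[A]_(q, s)).

Lemma map_scale_mull : map_mx ( *:%R r) M *m N = map_mx ( *:%R r) (M *m N).
Proof.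
apply/matrixP=> i j; rewrite !mxE scaler_sumr; apply: eq_bigr => l _.
by rewrite mxE scalerAl.
Qed.

Lemma map_scale_mulr : M *m map_mx ( *:%R r) N = map_mx ( *:%R r) (M *m N).
Proof.
apply/matrixP=> i j; rewrite !mxE scaler_sumr; apply: eq_bigr => l _.
by rewrite mxE scalerAr.
Qed.

End EntrywiseScale.

(** Entries in A become u x u blocks over A'. Conjugating the flattened matrix by the mutually
    inverse rectangular P and Q changes its size from d u to d'. *)
Lemma alg_iso_flatten (K : fieldType) (A A' : algType K) (d u d' : nat)
    (f : {lrmorphism A -> matalg A' u.+1}) : bijective f ->
  rectinv A' (d.+1 * u.+1) d'.+1 -> alg_iso (matalg A d.+1) (matalg A' d'.+1).
Proof.
move=> [g fK gK].
have -> : (d.+1 * u.+1 = \sum_(i < d.+1) u.+1)%N by rewrite sum_nat_const card_ord.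
case=> P [Q [PQ QP]].
pose flat (M : 'M[A]_d.+1) := \mxblock_(i < d.+1, j < d.+1) (f (M i j) : 'M_u.+1).
pose h (M : matalg A d.+1) : matalg A' d'.+1 := Q *m flat M *m P.
have flatD M N : flat (M + N) = flat M + flat N.
  rewrite /flat -mxblockD; apply: eq_mxblock => i j.
  by rewrite mxE; exact: rmorphD.
have flatM M N : flat (M *m N) = flat M *m flat N.
  rewrite /flat mul_mxblock; apply: eq_mxblock => i j.
  rewrite mxE; apply: etrans (raddf_sum f _ _ _) _.
  by apply: eq_bigr => z _; exact: rmorphM.
have flat1 : flat 1%:M = 1%:M.
  rewrite -mxdiagZ /mxdiag /flat; apply: eq_mxblock => i j; rewrite mxE.
  have [_|_] := eqVneq i j; last exact: raddf0.
  by rewrite conform_mx_id; exact: rmorph1.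
have [||hh hE] := @exists_lrmorphism K (matalg A d.+1) (matalg A' d'.+1) h.
- move=> r M N.
  have flatZ : flat (r *: M + N) = map_mx ( *:%R r) (flat M) + flat N.
    apply: etrans (flatD _ _) _; congr (_ + _); apply/mxblockP => i j.
    rewrite /submxblock -map_mxsub -!/(submxblock _ _ _) !mxblockK mxE.
    by transitivity (r *: (f (M i j) : matalg A' u.+1)); first exact: (linearZZ f).
  rewrite /h flatZ mulmxDr mulmxDl; congr (_ + _).
  by rewrite map_scale_mulr map_scale_mull.
- split=> [|M N]; first by rewrite /h flat1 mulmx1 QP.
  rewrite /h [in LHS]/GRing.mul /= flatM.
  rewrite [RHS](_ : _ = (Q *m flat M *m P) *m (Q *m flat N *m P)) //.
  by rewrite !mulmxA -(mulmxA _ P Q) PQ mulmx1.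
exists hh; apply: (eq_bij (f := h)); last by move=> M; rewrite hE.
exists (fun N : matalg A' d'.+1 => \matrix_(i, j) g (submxblock (P *m N *m Q) i j) : matalg A d.+1) => M.
  rewrite /h !mulmxA PQ mul1mx -!mulmxA PQ mulmx1.
  by apply/matrixP=> i j; rewrite mxE mxblockK fK.
rewrite /h; suff -> : flat (\matrix_(i, j) g (submxblock (P *m M *m Q) i j)) = P *m M *m Q.
  by rewrite !mulmxA QP mul1mx -mulmxA QP mulmx1.
by apply/mxblockP => i j; rewrite mxblockK mxE gK.
Qed.

(** * Grothendieck groups *)

Section ColumnModules.
Variables (K : fieldType) (A : algType K) (d : nat).
Let B : algType K := matalg A d.+1.

(** The sum of b copies of the column module, which corresponds to A^b under the Morita equivalence
    of A with its matrix algebra. *)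
Definition colmod (b : nat) : Type := 'M[A]_(d.+1, b).
HB.instance Definition _ b := GRing.Zmodule.copy (colmod b) 'M[A]_(d.+1, b).

Definition colmod_scale b (M : B) (x : colmod b) : colmod b :=
  (M : 'M[A]_d.+1) *m (x : 'M[A]_(d.+1, b)).

Fact colmod_scalerA b (M N : B) (x : colmod b) :
  colmod_scale M (colmod_scale N x) = colmod_scale (M * N) x.
Proof. exact: mulmxA. Qed.
Fact colmod_scale1r b : left_id 1 (@colmod_scale b).
Proof. exact: mul1mx. Qed.
Fact colmod_scalerDr b : right_distributive (@colmod_scale b) +%R.
Proof. by move=> M x y; apply: mulmxDr. Qed.
Fact colmod_scalerDl b (x : colmod b) : {morph (@colmod_scale b)^~ x : M N / M + N}.
Proof. by move=> M N; apply: mulmxDl. Qed.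

HB.instance Definition _ b := GRing.Zmodule_isLmodule.Build B (colmod b)
  (@colmod_scalerA b) (@colmod_scale1r b) (@colmod_scalerDr b)
  (@colmod_scalerDl b).

(** The coordinates of a dual basis with vectors [unit_row j] ([colmod_expand]), which proves
    projectivity although [colmod b] need not be free over B. *)
Definition single_col b (x : 'M[A]_(d.+1, b)) (j : 'I_b) : B :=
  x *m delta_mx j (0 : 'I_d.+1).

Definition unit_row b (j : 'I_b) : colmod b := delta_mx (0 : 'I_d.+1) j.

Lemma sum_single_col b c (x : 'M[A]_(d.+1, b)) (F : 'I_b -> 'M[A]_(d.+1, c)) :
  \sum_j (single_col x j : 'M_d.+1) *m F j =
  x *m \matrix_(j, l) F j 0 l.
Proof.
apply/matrixP=> i l; rewrite summxE mxE; apply: eq_bigr => j _.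
rewrite !mxE (bigD1 0) //= big1 ?addr0 => [|h h0]; last first.
  by rewrite mxE big1 ?mul0r // => m _; rewrite mxE (negPf h0) andbF mulr0.
rewrite mxE (bigD1 j) //= big1 ?addr0 => [|h hj].
  by rewrite mxE !eqxx mulr1.
by rewrite mxE (negPf hj) mulr0.
Qed.

Lemma colmod_expand b (x : colmod b) :
  x = \sum_j single_col x j *: unit_row j.
Proof.
apply/esym; apply: etrans (sum_single_col x (@unit_row b)) _.
suff -> : \matrix_(j, l) (unit_row j : 'M[A]_(d.+1, b)) 0 l = 1%:M by rewrite mulmx1.
by apply/matrixP=> j l; rewrite !mxE eqxx eq_sym.
Qed.

Lemma colmod_lift b (M : lmodType B) (w : 'I_b -> M) :
  exists p : {linear colmod b -> M}, forall x, p x = \sum_j single_col x j *: w j.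
Proof.
have [|p pE] := @exists_linear B (colmod b) M (fun x => \sum_j single_col x j *: w j).
  move=> a x y; rewrite scaler_sumr -big_split; apply: eq_bigr => j _ /=.
  rewrite scalerA -scalerDl; congr (_ *: _); rewrite /single_col.
  by apply: etrans (mulmxDl _ _ _) _; congr (_ + _); apply/esym/mulmxA.
by exists p.
Qed.

Lemma colmod_fg b : fin_generated (colmod b : lmodType B).
Proof.
exists b, (@unit_row b) => x.
by exists (single_col x); apply: colmod_expand.
Qed.

Lemma colmod_proj b : projective (colmod b : lmodType B).
Proof.
move=> S T p g psurj.
have /choice[s sP] j := psurj (g (unit_row j)).
have [h hE] := colmod_lift s; exists h => x.
rewrite hE linear_sum [in RHS](colmod_expand x) linear_sum.
by apply: eq_bigr => j _; rewrite !linearZ /= sP.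
Qed.

Lemma colmod_linear a b (f : {linear colmod a -> colmod b}) :
  exists E : 'M[A]_(a, b), forall x, f x = (x : 'M_(d.+1, a)) *m E.
Proof.
exists (\matrix_(j, l) (f (unit_row j) : 'M_(d.+1, b)) 0 l) => x.
rewrite -sum_single_col [in LHS](colmod_expand x) linear_sum.
by apply: eq_bigr => j _; rewrite linearZ.
Qed.

Lemma mulmx_ext a b (E F : 'M[A]_(a, b)) :
  (forall x : 'M[A]_(d.+1, a), x *m E = x *m F) -> E = F.
Proof.
move=> EF; apply/row_matrixP => i.
have := congr1 (row (0 : 'I_d.+1)) (EF (\matrix_(h, j) (i == j)%:R)).
rewrite !row_mul; suff -> : row 0 (\matrix_(h < d.+1, j < a) (i == j)%:R) = delta_mx 0 i :> 'rV[A]_a.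
  by rewrite -!rowE.
by apply/rowP => j; rewrite !mxE eqxx eq_sym.
Qed.

Lemma colmod_rectinv a b :
  linear_iso (colmod a : lmodType B) (colmod b) <-> rectinv A a b.
Proof.
split=> [ab|[P [Q [PQ QP]]]].
  case: (ab) => f [g fK gK]; have [|h hE] := @exists_linear B (colmod b) (colmod a) g.
    by move=> r x y; apply: (can_inj fK); rewrite linearP !gK.
  have [[P PE] [Q QE]] := (colmod_linear f, colmod_linear h).
  exists P, Q; split; apply: mulmx_ext => x; rewrite mulmxA mulmx1.
    by rewrite -PE -QE hE fK.
  by rewrite -QE -PE hE gK.
have [|f fE] := @exists_linear B (colmod a) (colmod b) (fun x => (x : 'M_(d.+1, a)) *m P).
  by move=> M x y; apply: etrans (mulmxDl _ _ _) _; congr (_ + _); apply/esym/mulmxA.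
exists f; exists (fun x : colmod b => (x : 'M_(d.+1, b)) *m Q : colmod a) => x.
  by rewrite fE -mulmxA PQ mulmx1.
by rewrite fE -mulmxA QP mulmx1.
Qed.

Lemma colmod_add a b :
  linear_iso (colmod (a + b) : lmodType B) (colmod a * colmod b)%type.
Proof.
have [|f fE] := @exists_linear B (colmod (a + b)) (colmod a * colmod b)%type
    (fun x => (lsubmx (x : 'M_(d.+1, a + b)), rsubmx (x : 'M_(d.+1, a + b)))).
  move=> M x y; congr (_, _) => /=.
    by apply: etrans (linearD _ _ _) _; congr (_ + _); apply/esym/mulmx_lsub.
  by apply: etrans (linearD _ _ _) _; congr (_ + _); apply/esym/mulmx_rsub.
exists f; exists (fun x : colmod a * colmod b => row_mx x.1 x.2 : colmod (a + b)) => x.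
  by rewrite fE hsubmxK.
by rewrite fE row_mxKl row_mxKr; case: x.
Qed.

Lemma colmod_regular : linear_iso (colmod d.+1 : lmodType B) B^o.
Proof.
have [|f fE] := @exists_linear B (colmod d.+1) B^o (fun x => x : B); first by [].
by exists f; exists (fun x : B^o => x : 'M_d.+1) => x; rewrite fE.
Qed.

(** Each generator v_i is replaced by d + 1 vectors E_0h v_i, and column h of its coefficient
    becomes the coordinate there. *)
Lemma colmod_surj (M : lmodType B) : fin_generated M ->
  exists b (p : {linear colmod b -> M}), forall y, exists x, p x = y.
Proof.
case=> r [v vgen]; pose T : finType := ('I_r * 'I_d.+1)%type.
pose w (t : 'I_#|T|) : M :=
  ((delta_mx 0 (enum_val t).2 : 'M[A]_d.+1) : B) *: v (enum_val t).1.
have [p pE] := colmod_lift w; exists #|T|, p => y.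
have [c yE] := vgen y.
exists (\matrix_(i, t) (c (enum_val t).1 : 'M_d.+1) i (enum_val t).2).
rewrite pE yE; transitivity (\sum_(t : T)
    ((\matrix_(i, j) (if j == t.2 then (c t.1 : 'M_d.+1) i j else 0) : 'M_d.+1) : B) *: v t.1).
  rewrite [RHS](reindex _ (onW_bij _ (@enum_val_bij T))).
  apply: eq_bigr => t _; rewrite /w scalerA; congr (_ *: _).
  apply/matrixP=> i j; rewrite [LHS]mxE mxE (bigD1 0) //= big1 ?addr0 => [|h h0]; last first.
    by rewrite /single_col !mxE big1 ?mul0r // => m _; rewrite !mxE (negPf h0) andbF mulr0.
  rewrite /single_col !mxE (bigD1 t) //= big1 ?addr0 => [|h ht].
    rewrite !mxE !eqxx /= mulr1; case: eqP => [->|_]; last by rewrite mulr0.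
    by rewrite mulr1.
  by rewrite !mxE (negPf ht) mulr0.
rewrite -(pair_bigA _ (fun i j => ((\matrix_(a, b) (if b == j then (c i : 'M_d.+1) a b
   else 0) : 'M_d.+1) : B) *: v i)) /=.
apply: eq_bigr => i _; rewrite -scaler_suml; congr (_ *: _).
apply/matrixP=> a b; rewrite summxE (bigD1 b) //= big1 => [|j jb].
  by rewrite mxE eqxx addr0.
by rewrite mxE eq_sym (negPf jb).
Qed.

End ColumnModules.

Lemma class_ofP (R : pzRingType) (M N : lmodType R) (fgM : fin_generated M) (pM : projective M)
  (fgN : fin_generated N) (pN : projective N) :
  class_of fgM pM = class_of fgN pN <-> linear_iso M N.
Proof.
rewrite isoclassP; split=> MN.
  apply: linear_iso_trans (fgproj_reprP fgM pM) _.
  exact: linear_iso_trans MN (linear_iso_sym (fgproj_reprP fgN pN)).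
apply: linear_iso_trans (linear_iso_sym (fgproj_reprP fgM pM)) _.
exact: linear_iso_trans MN (fgproj_reprP fgN pN).
Qed.

Lemma to_grothD (V : nmodType) (a b : V) :
  to_groth (a + b) = to_groth a + to_groth b.
Proof. by apply/esym; rewrite [LHS]groth_addE /= addr0. Qed.

Lemma grothE (V : nmodType) (z : groth V) :
  exists a b : V, z = to_groth a - to_groth b.
Proof.
elim/quotW: z => -[a b]; exists a, b.
by rewrite [- _]groth_oppE [RHS]groth_addE /= addr0 add0r.
Qed.

(** * The group K_0 of a matrix algebra over L *)

Section LeavittK0.
Variables (K : fieldType) (k d : nat).
Local Notation L := (leavitt K k.+2).
Let B : algType K := matalg L d.+1.
Local Notation col b := (colmod L d b : lmodType B).

(* M is the image of an idempotent matrix E = H G with G of independent rows, *)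
(* whence G H = 1.                                                            *)
Lemma fgproj_colmod (M : lmodType B) : fin_generated M -> projective M ->
  exists b, linear_iso M (col b).
Proof.
move=> fgM pM; have [N [p psurj]] := colmod_surj fgM.
have [|i iE] := @exists_linear B M M id; first by [].
have [s sK0] := pM _ _ p i psurj.
have sK y : p (s y) = y by rewrite sK0 iE.
have [|e eE] := @exists_linear B (col N) (col N) (s \o p).
  by move=> M' x y; rewrite /= !linearP.
have [E EP] := colmod_linear e.
have EE : E *m E = E.
  by apply: (@mulmx_ext K L d) => x; rewrite mulmxA -!EP !eE /= sK.
have [b [G [H [H' [EH GE indep]]]]] := row_col_free E.
have GE' : G *m E = G by rewrite GE -mulmxA EE.
have GH : G *m H = 1%:M.
  apply/row_matrixP => j; apply/eqP; rewrite -subr_eq0 -linearB; apply/eqP.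
  by apply: indep; rewrite -row_mul mulmxBl -mulmxA -EH GE' mul1mx subrr linear0.
exists b; apply: linear_iso_sym.
have [|f fE] := @exists_linear B (col b) M
    (fun x => p ((x : 'M_(d.+1, b)) *m G : 'M_(d.+1, N))).
  move=> r x y; rewrite -linearP; congr (p _).
  by apply: etrans (mulmxDl _ _ _) _; congr (_ + _); apply/esym/mulmxA.
exists f; exists (fun y => (s y : 'M_(d.+1, N)) *m H : 'M_(d.+1, b)) => [x|y].
  rewrite fE -[X in X *m H]/((s \o p) _) -eE EP -!mulmxA (mulmxA G E) GE' GH.
  by rewrite mulmx1.
by rewrite fE -mulmxA -EH -EP eE /= !sK.
Qed.

Definition col_class b : isoclass B :=
  class_of (colmod_fg L d b) (@colmod_proj K L d b).

Lemma col_class_eq a b : col_class a = col_class b <-> rectinv L a b.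
Proof. by rewrite class_ofP colmod_rectinv. Qed.

Lemma col_class_surj (z : isoclass B) : exists b, z = col_class b.
Proof.
elim/quotW: z => P; have [b Pb] := fgproj_colmod (fgp_fg P) (fgp_proj P).
exists b; apply/isoclassP; exact: linear_iso_trans Pb (fgproj_reprP _ _).
Qed.

Lemma col_classD a b : col_class (a + b) = col_class a + col_class b.
Proof.
rewrite [RHS]iso_addE; apply/isoclassP.
apply: linear_iso_trans (linear_iso_sym (fgproj_reprP _ _)) _.
apply: linear_iso_trans (colmod_add L d a b) _.
apply: linear_iso_trans (fgp_addP _ _).
by apply: linear_iso_prod; apply: fgproj_reprP.
Qed.

Definition K0_col : K0 B := to_groth (col_class 1).

Lemma K0_colE a : to_groth (col_class a) = K0_col *+ a.
Proof.
elim: a => [|a IHa]; last by rewrite -add1n col_classD to_grothD IHa mulrS.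
(* The class of [colmod 0] equals its double, so it vanishes in the group. *)
have := to_grothD (col_class 0) (col_class 0); rewrite -col_classD addn0 => e.
by rewrite mulr0n; apply: (addrI (to_groth (col_class 0))); rewrite addr0 -e.
Qed.

Lemma K0_col_eq a b : K0_col *+ a = K0_col *+ b <-> a = b %[mod k.+1]%N.
Proof.
rewrite -!K0_colE; split=> [/grothP[z] /=|ab].
  have [c ->] := col_class_surj z; rewrite !addr0 -!col_classD col_class_eq.
  by move/rectinv_leavitt_eqmod/eqP; rewrite eqn_modDr => /eqP.
(* One more column on each side makes both ranks positive, as [rectinv_leavitt_mod] requires. *)
apply: (addIr (to_groth (col_class 1))); rewrite -!to_grothD -!col_classD.
congr (to_groth _); apply/col_class_eq/rectinv_leavitt_mod; rewrite ?addn1 //.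
by apply/eqP; rewrite -(addn1 a) -(addn1 b) eqn_modDr ab.
Qed.

Lemma K0_col_eq0 a : K0_col *+ a = 0 <-> (k.+1 %| a)%N.
Proof.
rewrite -[0](mulr0n K0_col) K0_col_eq mod0n; split=> [/eqP //|/eqP].
exact.
Qed.

Lemma K0_col_gen (z : K0 B) : exists a, z = K0_col *+ a.
Proof.
have [p [q ->]] := grothE z.
have [[a ->] [b ->]] := (col_class_surj p, col_class_surj q).
(* The generator is killed by k + 1, so its multiple by b k is the opposite of its multiple by b. *)
rewrite !K0_colE; exists (a + b * k)%N; rewrite mulrnDr; congr (_ + _).
apply: (addrI (K0_col *+ b)); rewrite subrr -mulrnDr -mulnS.
by apply/esym/K0_col_eq0; rewrite dvdn_mull.
Qed.

Lemma K0_oneE : K0_one B = K0_col *+ d.+1.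
Proof.
rewrite -K0_colE; congr (to_groth _); apply/class_ofP.
exact/linear_iso_sym/colmod_regular.
Qed.

End LeavittK0.

(** * Functoriality of K_0 under isomorphisms *)

Definition restr (R S : pzRingType) (e : {rmorphism R -> S})
  (M : lmodType S) : Type := M.

Section Restriction.
Variables (R S : pzRingType) (e : {rmorphism R -> S}).
Local Notation restr := (restr e).

HB.instance Definition _ (M : lmodType S) := GRing.Zmodule.copy (restr M) M.

Definition restr_scale (M : lmodType S) (a : R) (x : restr M) : restr M :=
  e a *: (x : M).

Fact restr_scalerA M (a b : R) (x : restr M) :
  restr_scale a (restr_scale b x) = restr_scale (a * b) x.
Proof. by rewrite /restr_scale scalerA rmorphM. Qed.
Fact restr_scale1r M : left_id 1 (@restr_scale M).
Proof. by move=> x; rewrite /restr_scale rmorph1 scale1r. Qed.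
Fact restr_scalerDr M : right_distributive (@restr_scale M) +%R.
Proof. by move=> a x y; apply: scalerDr. Qed.
Fact restr_scalerDl M (x : restr M) : {morph (@restr_scale M)^~ x : a b / a + b}.
Proof. by move=> a b; rewrite /restr_scale rmorphD; apply: scalerDl. Qed.

HB.instance Definition _ (M : lmodType S) :=
  GRing.Zmodule_isLmodule.Build R (restr M) (@restr_scalerA M)
    (@restr_scale1r M) (@restr_scalerDr M) (@restr_scalerDl M).

Lemma restr_linear (M N : lmodType S) (f : {linear M -> N}) :
  exists g : {linear restr M -> restr N}, forall x : M, g x = f x.
Proof. by apply: exists_linear => a x y; apply: linearP. Qed.

Lemma restr_iso (M N : lmodType S) :
  linear_iso M N -> linear_iso (restr M) (restr N).
Proof.
case=> f bf; have [g gE] := restr_linear f.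
by exists g; apply: (eq_bij bf) => x; rewrite gE.
Qed.

Lemma restr_prod (M N : lmodType S) :
  linear_iso (restr (M * N)%type) (restr M * restr N)%type.
Proof.
have [|f fE] := @exists_linear R (restr (M * N)%type) (restr M * restr N)%type
  (fun x => x); first by [].
by exists f; exists (fun x => x) => x; rewrite fE.
Qed.

End Restriction.

Section RestrictionIso.
Variables (R S : pzRingType) (e : {rmorphism R -> S}) (e' : {rmorphism S -> R}).
Hypotheses (eK : cancel e e') (e'K : cancel e' e).

Lemma restrK (M : lmodType S) : linear_iso (restr e' (restr e M)) M.
Proof.
have [|f fE] := @exists_linear S (restr e' (restr e M)) M (fun x => x).
  move=> a x y; congr (_ + _).
  by change (e (e' a) *: (x : M) = a *: (x : M)); rewrite e'K.
by exists f; exists (fun x => x) => x; rewrite fE.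
Qed.

Lemma restr_regular : linear_iso R^o (restr e S^o).
Proof.
have [|f fE] := @exists_linear R R^o (restr e S^o) (fun a => e a : S^o).
  by move=> a x y; apply: etrans (rmorphD e _ _) _; congr (_ + _); apply: rmorphM.
by exists f; exists (fun a : restr e S^o => e' (a : S^o) : R^o) => x; rewrite fE.
Qed.

Lemma restr_fg (M : lmodType S) : fin_generated M -> fin_generated (restr e M).
Proof.
case=> m [v vgen]; exists m, v => x; have [c xE] := vgen x.
exists (fun i => e' (c i)); apply: etrans xE _; apply: eq_bigr => i _.
by change (c i *: v i = e (e' (c i)) *: v i); rewrite e'K.
Qed.

Lemma restr_proj (M : lmodType S) : projective M -> projective (restr e M).
Proof.
move=> pM T U p g psurj; have [p' p'E] := restr_linear e' p.
have [|g' g'E] := @exists_linear S M (restr e' U) (fun x => g (x : restr e M)).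
  move=> a x y; rewrite -[a in LHS]e'K.
  exact: (linearP g (e' a) (x : restr e M) (y : restr e M)).
have [|h hE] := pM _ _ p' g'; first by move=> y; have [x <-] := psurj y; exists x.
have [|h' h'E] := @exists_linear R (restr e M) T (fun x => h (x : M)).
  move=> a x y; apply: etrans (linearP h (e a) (x : M) (y : M)) _; congr (_ + _).
  by change (e' (e a) *: (h x : T) = a *: (h x : T)); rewrite eK.
by exists h' => m; rewrite h'E -p'E hE g'E.
Qed.

Definition isoclass_restr (z : isoclass S) : isoclass R :=
  class_of (restr_fg (fgp_fg (repr z))) (restr_proj (fgp_proj (repr z))).

Lemma isoclass_restrE (M : lmodType S) (fgM : fin_generated M) (pM : projective M) :
  isoclass_restr (class_of fgM pM) = class_of (restr_fg fgM) (restr_proj pM).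
Proof.
apply/class_ofP/restr_iso; apply: linear_iso_trans (linear_iso_sym (fgproj_reprP fgM pM)).
by apply/isoclassP; rewrite reprK.
Qed.

Lemma isoclassE (T : pzRingType) (z : isoclass T) :
  z = class_of (fgp_fg (repr z)) (fgp_proj (repr z)).
Proof.
by rewrite -[LHS]reprK; apply/isoclassP/fgproj_reprP.
Qed.

Lemma class_of_add (T : pzRingType) (M N : lmodType T)
  (fgM : fin_generated M) (pM : projective M)
  (fgN : fin_generated N) (pN : projective N) :
  class_of fgM pM + class_of fgN pN =
  class_of (fin_generated_prod fgM fgN) (projective_prod pM pN).
Proof.
rewrite [LHS]iso_addE; apply/isoclassP.
apply: linear_iso_trans (linear_iso_sym (fgp_addP _ _)) _.
apply: linear_iso_trans (fgproj_reprP _ _).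
by apply: linear_iso_prod; apply/linear_iso_sym/fgproj_reprP.
Qed.

Lemma isoclass_restrD (z t : isoclass S) :
  isoclass_restr (z + t) = isoclass_restr z + isoclass_restr t.
Proof.
rewrite (isoclassE z) (isoclassE t) class_of_add !isoclass_restrE class_of_add.
exact/class_ofP/restr_prod.
Qed.

End RestrictionIso.

Lemma isoclass_restrK (R S : pzRingType) (e : {rmorphism R -> S})
    (e' : {rmorphism S -> R}) (eK : cancel e e') (e'K : cancel e' e) :
  cancel (isoclass_restr eK e'K) (isoclass_restr e'K eK).
Proof.
move=> z; rewrite {1}(isoclassE z) !isoclass_restrE [RHS]isoclassE.
exact/class_ofP/restrK.
Qed.

Lemma groth_lift (V W : nmodType) (h : V -> W) : {morph h : a b / a + b} ->
  exists phi : {additive groth V -> groth W},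
    forall a, phi (to_groth a) = to_groth (h a).
Proof.
move=> hD; pose p (z : groth V) := to_groth (h (repr z).1) - to_groth (h (repr z).2).
have pE a b : p (to_groth a - to_groth b) = to_groth (h a) - to_groth (h b).
  have zE : to_groth a - to_groth b = \pi_(groth V)%qT (a, b).
    by rewrite [- _]groth_oppE [LHS]groth_addE /= addr0 add0r.
  rewrite zE /p; set z := repr _.
  have /grothP[s sE] : \pi_(groth V)%qT z = \pi_(groth V)%qT (a, b) by rewrite reprK.
  apply/eqP; rewrite subr_eq addrAC eq_sym subr_eq -!to_grothD -!hD /=; apply/eqP.
  apply: (addIr (to_groth (h s))); rewrite -!to_grothD -!hD.
  by move: sE => /= <-; rewrite addrC.
have pB : zmod_morphism p.
  move=> z t; have [[a [b ->]] [a' [b' ->]]] := (grothE z, grothE t).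
  have -> : to_groth a - to_groth b - (to_groth a' - to_groth b') =
      to_groth (a + b') - to_groth (b + a').
    by rewrite !to_grothD !opprD opprK [LHS](AC (2*2) ((1*4)*(2*3)))%AC.
  rewrite !pE !hD !to_grothD !opprD opprK.
  by rewrite [RHS](AC (2*2) ((1*4)*(2*3)))%AC.
pose m := GRing.isZmodMorphism.Build _ _ p pB.
pose phi : {additive groth V -> groth W} := HB.pack p m.
exists phi => a; have := pE (a + a) a; rewrite hD !to_grothD !addrK.
exact.
Qed.

(** A-modules become B-modules by restriction along the inverse B -> A, and f itself gives the
    inverse map on K_0. *)
Lemma alg_iso_K0 (K : fieldType) (A B : algType K) : alg_iso A B ->
  exists phi : {additive K0 A -> K0 B}, bijective phi /\ phi (K0_one A) = K0_one B.
Proof.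
case=> f [g fK gK].
have [||g' g'E] := @exists_lrmorphism K B A g.
- move=> r x y; apply: (can_inj fK); rewrite gK; apply/esym.
  by apply: etrans (linearP f r (g x) (g y)) _; rewrite /= !gK.
- split=> [|x y]; apply: (can_inj fK); rewrite gK; apply/esym; first exact: rmorph1.
  by apply: etrans (rmorphM f (g x) (g y)) _; rewrite /= !gK.
have fK' : cancel f g' by move=> x; rewrite g'E.
have gK' : cancel g' f by move=> x; rewrite g'E.
have [phi phiE] := groth_lift (isoclass_restrD (e := g') gK' fK').
have [psi psiE] := groth_lift (isoclass_restrD (e := f) fK' gK').
exists phi; split.
  by exists psi => z; have [a [b ->]] := grothE z;
    rewrite !raddfB /= ?phiE ?psiE ?phiE ?psiE !isoclass_restrK.
rewrite phiE; congr (to_groth _); rewrite isoclass_restrE; apply/class_ofP.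
exact: linear_iso_sym (restr_regular gK' fK').
Qed.

(** The generators are exchanged up to factors u and v with u v = 1 mod n' - 1, so u is a unit.
    Comparing which multiples of the generator vanish gives n = n', and comparing the classes of the
    rings gives the congruence. *)
Lemma K0_iso_invariants (K : fieldType) (d k d' k' : nat)
    (phi : {additive K0 (matalg (leavitt K k.+2) d.+1) ->
                     K0 (matalg (leavitt K k'.+2) d'.+1)}) :
  bijective phi -> phi (K0_one _) = K0_one _ ->
  k = k' /\ exists u, coprime u.+1 k.+1 /\ (d.+1 * u.+1 = d'.+1 %[mod k.+1])%N.
Proof.
move=> bphi; rewrite !K0_oneE raddfMn => phi1.
have [u uE] := K0_col_gen (phi (K0_col K k d)).
have [psi phiK psiK] := bphi; have [v vE] := K0_col_gen (psi (K0_col K k' d')).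
have phiE a : phi (K0_col K k d *+ a) = K0_col K k' d' *+ (u * a)%N.
  by rewrite raddfMn uE mulrnA.
have uv : (u * v = 1 %[mod k'.+1])%N.
  by apply/(K0_col_eq K k' d'); rewrite -phiE -vE psiK.
have phi_eq0 a : (k'.+1 %| u * a)%N <-> (k.+1 %| a)%N.
  split=> [/(K0_col_eq0 K k' d') e|/(K0_col_eq0 K k d) e].
    apply/(K0_col_eq0 K k d)/(bij_inj bphi).
    by apply: etrans (phiE a) _; rewrite e raddf0.
  by apply/(K0_col_eq0 K k' d'); rewrite -phiE e raddf0.
have cop : coprime u k'.+1.
  have : coprime (u * v) k'.+1 by rewrite -coprime_modl uv coprime_modl coprime1n.
  by rewrite coprimeMl => /andP[].
have kk : k = k'.
  apply/eqP; rewrite -eqSS eqn_dvd; apply/andP; split.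
    by apply/phi_eq0; rewrite dvdn_mull.
  by have /phi_eq0 := dvdnn k.+1; rewrite Gauss_dvdr // coprime_sym.
(* Adding n' - 1 to u keeps its residue and makes it positive. *)
split=> //; rewrite kk; exists (u + k')%N; rewrite -addnS; split.
  by rewrite -coprime_modl modnDr coprime_modl.
rewrite -modnMmr modnDr modnMmr mulnC; apply/(K0_col_eq K k' d').
by rewrite -[RHS]phi1 uE mulrnA.
Qed.

Theorem theorem5p2 (K : fieldType) (d n d' n' : nat) :
  let B : algType K := matalg (leavitt K n.+2) d.+1 in
  let B' : algType K := matalg (leavitt K n'.+2) d'.+1 in
  alg_iso B B' <->
  exists phi : {additive K0 B -> K0 B'},
    bijective phi /\ phi (K0_one B) = K0_one B'.
Proof.
move=> B B'; split=> [|[phi [bphi phi1]]]; first exact: alg_iso_K0.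
have [nn [u [cop du]]] := K0_iso_invariants bphi phi1.
(* L is replaced by M_u(L), and the sizes d u and d' agree modulo n - 1. *)
rewrite /B /B' -nn; have [f bf] := leavitt_matrix_iso K cop.
exact/(alg_iso_flatten bf)/rectinv_leavitt_mod.
Qed.
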